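(* Let $A_6$ be the alternating group of degree 6. The following d-identities form a basis of d-identities of $A_6$; that is, each of them holds in $A_6$, and every group in which all of them hold is isomorphic to a section (a quotient of a subgroup) of $A_6$: (1) $\omega_{360}=\bigvee_{0\le i<j\le 360}(x_i=x_j)$; (2) $(x^3=1)\vee(x^4=1)\vee(x^5=1)$; (3) in variables $x_1,\dots,x_9$, with $i,j$ ranging over $\{1,\dots,9\}$: $\Big[\bigvee_{i} x_i^{20}=1\Big]\vee\Big[\bigvee_{i<j}x_i=x_j\Big]\vee\Big[\bigvee_{i<j}(x_ix_j)^{20}=1\Big]\vee\Big[\bigvee_{i<j}(x_ix_j^2)^{20}=1\Big]$; (4) $(x_1^{30}=1)\vee(x_2^{30}=1)\vee((x_1x_2)^{15}=1)\vee((x_1x_2^2)^{15}=1)\vee((x_1x_2^3)^{15}=1)$; (5) in variables $x_1,x_2,x_3$, with $i,j$ ranging over $\{1,2,3\}$: $\theta(x_1,x_2,x_3)\vee\Big[\bigvee_i x_i^{15}=1\Big]\vee\Big[\bigvee_{i\ne j}(x_ix_j)^{15}=1\Big]\vee\Big[\bigvee_{i\ne j}(x_ix_j^2)^{15}=1\Big]\vee\Big[\bigvee_{i\ne j}(x_ix_j^3)^{15}=1\Big]$; (6) $(x_1^{12}=1)\vee(x_2^{30}=1)\vee\big((x_1\,x_2^{-1}x_1x_2)^{12}=1\big)\vee\big((x_1\,x_2^{-1}x_1^3x_2)^{12}=1\big)\vee\big((x_1^2\,x_2^{-1}x_1x_2)^{12}=1\big)$; (7) $(x_1^{12}=1)\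vee(x_2^{12}=1)\vee\bigvee_{d=1}^{4}\big((x_1x_2^d)^{12}=1\big)$.
   Context: A d-identity (disjunctive identity) is a universally quantified formula $\forall x_1\dots x_k\,[(f_1=1)\vee\dots\vee(f_n=1)]$ with the $f_i$ words in the free group on the variables; an equation $u=v$ abbreviates $uv^{-1}=1$. A group satisfies it if it is true for all assignments of group elements. For a group $G$, $\mathrm{dvar}(G)$ is the class of groups satisfying every d-identity satisfied by $G$; for finite $G$ it is exactly the class of groups isomorphic to sections of $G$. A set of d-identities is a basis of d-identities of $G$ if all its members hold in $G$ and every group satisfying them lies in $\mathrm{dvar}(G)$. Notation: ''$u\in\langle v\rangle$'' abbreviates $(u=1)\vee(u=v)\vee(u=v^2)\vee(u=v^3)$, and $\theta(z_1,z_2,z_3)$ denotes $\Big[\bigvee_{i\ne j} z_i\in\langle z_j\rangle\Big]\vee\Big[\bigvee_{\sigma\in S_3} z_{\sigma(1)}\in\langle z_{\sigma(2)}z_{\sigma(3)}\rangle\Big]\vee\Big[\bigvee_{\sigma\in S_3} z_{\sigma(1)}z_{\sigma(2)}\in\langle z_{\sigma(2)}z_{\sigma(3)}\rangle\Big]$ with $i,j\in\{1,2,3\}$. *)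

(* Defs.v *)
From mathcomp Require Import all_boot all_fingroup all_solvable.
Set Implicit Arguments. Unset Strict Implicit. Unset Printing Implicit Defensive.

Record agroup := Group {
  carrier :> Type;
  gmul : carrier -> carrier -> carrier;
  ginv : carrier -> carrier;
  gone : carrier;
  gmulA : forall x y z, gmul x (gmul y z) = gmul (gmul x y) z;
  gmul1 : forall x, gmul gone x = x;
  gmulV : forall x, gmul (ginv x) x = gone }.

Definition gpow (G : agroup) (x : G) (n : nat) : G := iter n (gmul x) (gone G).

Definition group_of_fin (gT : finGroupType) : agroup :=
  @Group gT mulg invg 1%g (@mulgA gT) (@mul1g gT) (@mulVg gT).

Definition A6 : agroup := group_of_fin [subg ('Alt_('I_6))%G].

Section Identities.
Variable G : agroup.
Local Notation "x * y" := (gmul x y).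
Local Notation "x ^ n" := (gpow x n).
Local Notation "1" := (gone G).

Definition in_cyc (u v : G) : Prop := u = 1 \/ u = v \/ u = v ^ 2 \/ u = v ^ 3.

(* theta(z1,z2,z3); a permutation sigma of {1,2,3} is given by the
   pairwise distinct triple (sigma 1, sigma 2, sigma 3) = (i, j, k). *)
Definition theta (z : 'I_3 -> G) : Prop :=
  (exists i j : 'I_3, i <> j /\ in_cyc (z i) (z j)) \/
  (exists i j k : 'I_3, [/\ i <> j, j <> k & i <> k] /\ in_cyc (z i) (z j * z k)) \/
  (exists i j k : 'I_3, [/\ i <> j, j <> k & i <> k] /\ in_cyc (z i * z j) (z j * z k)).

Definition did1 : Prop :=
  forall x : 'I_361 -> G, exists i j : 'I_361, (i < j)%N /\ x i = x j.

Definition did2 : Prop :=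
  forall x : G, x ^ 3 = 1 \/ x ^ 4 = 1 \/ x ^ 5 = 1.

Definition did3 : Prop :=
  forall x : 'I_9 -> G,
    (exists i, x i ^ 20 = 1) \/
    (exists i j : 'I_9, (i < j)%N /\ x i = x j) \/
    (exists i j : 'I_9, (i < j)%N /\ (x i * x j) ^ 20 = 1) \/
    (exists i j : 'I_9, (i < j)%N /\ (x i * x j ^ 2) ^ 20 = 1).

Definition did4 : Prop :=
  forall x1 x2 : G,
    x1 ^ 30 = 1 \/ x2 ^ 30 = 1 \/ (x1 * x2) ^ 15 = 1 \/
    (x1 * x2 ^ 2) ^ 15 = 1 \/ (x1 * x2 ^ 3) ^ 15 = 1.

Definition did5 : Prop :=
  forall x : 'I_3 -> G,
    theta x \/
    (exists i, x i ^ 15 = 1) \/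
    (exists i j : 'I_3, i <> j /\ (x i * x j) ^ 15 = 1) \/
    (exists i j : 'I_3, i <> j /\ (x i * x j ^ 2) ^ 15 = 1) \/
    (exists i j : 'I_3, i <> j /\ (x i * x j ^ 3) ^ 15 = 1).

Definition did6 : Prop :=
  forall x1 x2 : G,
    x1 ^ 12 = 1 \/ x2 ^ 30 = 1 \/
    (x1 * (ginv x2 * (x1 * x2))) ^ 12 = 1 \/
    (x1 * (ginv x2 * (x1 ^ 3 * x2))) ^ 12 = 1 \/
    (x1 ^ 2 * (ginv x2 * (x1 * x2))) ^ 12 = 1.

Definition did7 : Prop :=
  forall x1 x2 : G,
    x1 ^ 12 = 1 \/ x2 ^ 12 = 1 \/
    exists d : nat, (1 <= d <= 4)%N /\ (x1 * x2 ^ d) ^ 12 = 1.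

Definition all_dids : Prop :=
  did1 /\ did2 /\ did3 /\ did4 /\ did5 /\ did6 /\ did7.

End Identities.

Definition is_section_of (G : agroup) (gT : finGroupType) (K : {group gT}) : Prop :=
  exists (H N : {group gT}), [/\ H \subset K, (N <| H)%g &
    exists f : G -> coset_of N,
      [/\ forall x y, f (gmul x y) = (f x * f y)%g,
          injective f &
          forall c, c \in (H / N)%g <-> exists x, f x = c]].

(* Main.v *)
(* For A_6 the identities are checked by computation on the tables of its
   elements.  Conversely (1) makes G finite, and the other identities bound its
   local structure: by (2) element orders are at most 5, so centralisers of
   nontrivial p-elements are p-groups; (3) and (7) bound the Sylow 3- and
   5-subgroups by 9 and 5, (4) leaves at most one cyclic subgroup of order 4 in
   a 2-subgroup, (5) excludes elementary abelian 2-subgroups of order 8, so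
   Sylow 2-subgroups have order at most 8, and (6) excludes the Frobenius group
   of order 20.  Hence |G| divides 360.

   If 5 does not divide |G|, then either |G| is a power of 2, or the Sylow
   3-subgroup P is normal, with a cyclic complement of order 1, 2 or 4 when
   |P| = 9, or G acts faithfully on its four Sylow 3-subgroups.  If 5 divides
   |G|, the normaliser of a Sylow 5-subgroup has order 5 or 10, and Sylow's
   theorem together with counting the elements of orders 3 and 5 leaves
   |G| = 5, 10, 60 or 360.  A group of order 60 acts on its six Sylow
   5-subgroups.  In a group of order 360 one finds x, s of orders 3 and 2 with
   x s of order 5; they generate a subgroup of order 60, and G acts on its six
   cosets.  These actions are even because a subgroup of index 2 would have the
   excluded order 30 or 180. *)
Require Import Defs.
From Stdlib Require Import ClassicalEpsilon.
From HB Require Import structures.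
From mathcomp Require Import all_boot all_fingroup all_solvable.
From mathcomp Require Import zify.
Set Implicit Arguments. Unset Strict Implicit. Unset Printing Implicit Defensive.
Local Open Scope group_scope.
(** * Permutations of six points as lists of values *)

Definition tab (s : {perm 'I_6}) : seq nat :=
  [seq val (s (inord i)) | i <- iota 0 6].
(** Left-to-right composition: [a] acts first, as in the product of permutations. *)
Definition tmul (a b : seq nat) : seq nat := [seq nth 0 b i | i <- a].
Definition tone : seq nat := iota 0 6.

Lemma size_tab s : size (tab s) = 6.
Proof. by rewrite size_map size_iota. Qed.

Lemma nth_tab s (i : 'I_6) : nth 0 (tab s) i = s i.
Proof. by rewrite (nth_map 0) ?size_iota // nth_iota // inord_val. Qed.

Lemma tab_inj : injective tab.
Proof.
by move=> s t e; apply/permP=> i; apply: val_inj; rewrite /= -!nth_tab e.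
Qed.

Lemma tab1 : tab 1 = tone.
Proof.
by rewrite /tab -[RHS]map_id; apply/eq_in_map=> i; rewrite mem_iota perm1 => /inordK.
Qed.

Lemma tabM s t : tab (s * t) = tmul (tab s) (tab t).
Proof. by rewrite /tmul /tab -map_comp; apply: eq_map => i /=;
  rewrite permM nth_tab. Qed.

Lemma tab_perm s : perm_eq (tab s) tone.
Proof.
have ut : uniq (tab s).
  rewrite map_inj_in_uniq ?iota_uniq // => i j;
    rewrite !mem_iota => lti ltj /val_inj/perm_inj.
  by move/(congr1 val); rewrite /= !inordK.
have [//||_ e] := uniq_min_size (s2 := tone) ut; rewrite ?size_tab //.
  by move=> i /mapP[j _ ->]; rewrite mem_iota ltn_ord.
by apply: uniq_perm; rewrite ?iota_uniq.
Qed.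

(** Lets a concrete permutation be introduced by its table, so that its properties are checked by
    computation. *)
Lemma tab_surj t : perm_eq t tone -> exists s, tab s = t.
Proof.
move=> pt; have st : size t = 6 by rewrite (perm_size pt).
have ut : uniq t by rewrite (perm_uniq pt) iota_uniq.
have lt (i : 'I_6) : nth 0 t i < 6.
  have : nth 0 t i \in t by rewrite mem_nth ?st.
  by rewrite (perm_mem pt) mem_iota.
have inj : injective (fun i : 'I_6 => Ordinal (lt i)).
  by move=> i j /(congr1 val)/= /eqP; rewrite nth_uniq ?st // => /eqP/val_inj.
exists (perm inj); apply: (@eq_from_nth _ 0); rewrite size_tab // => i lti.
by rewrite -[i]/(val (Ordinal lti)) nth_tab permE.
Qed.

(* The parity of the number of inversions. *)
Fixpoint tinv (t : seq nat) : bool :=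
  if t is a :: t' then odd (count (fun b => b < a) t') (+) tinv t' else false.

Definition tswap (i j : nat) : seq nat :=
  mkseq (fun k => if k == i then j else if k == j then i else k) 6.

Lemma tab_tperm (i j : 'I_6) : tab (tperm i j) = tswap i j.
Proof.
apply/eq_in_map => k; rewrite mem_iota /= add0n => ltk.
rewrite permE /= -!val_eqE /= inordK //.
by case: ifP => // _; case: ifP => // _; rewrite /= inordK.
Qed.

Lemma tinv_swap i j t : i < 6 -> j < 6 -> i != j -> perm_eq t tone ->
  tinv (tmul (tswap i j) t) = ~~ tinv t.
Proof.
move=> lti ltj dij; rewrite -mem_permutations.
have : all (fun i => all (fun j => (i != j) ==>
    all (fun t => tinv (tmul (tswap i j) t) == ~~ tinv t) (permutations tone))
    (iota 0 6)) (iota 0 6) by vm_compute.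
(* The list of 720 tables is generalised so that later steps do not unfold it. *)
move: (permutations tone) => L /allP/(_ i); rewrite mem_iota => /(_ lti).
move/allP/(_ j); rewrite mem_iota => /(_ ltj) /implyP/(_ dij).
by move=> /allP h Lt; apply/eqP/h.
Qed.

(** Each transposition in a decomposition of [s] flips both parities. *)
Lemma tinv_tab s : tinv (tab s) = s :> bool.
Proof.
have [ts -> dts] := prod_tpermP s.
elim: ts dts => [|[i j] ts IH]; first by rewrite big_nil tab1 odd_perm1.
case/andP=> dij /IH {}IH; rewrite big_cons odd_mul_tperm [i != j]dij -IH tabM.
by rewrite tab_tperm tinv_swap ?tab_perm.
Qed.

Definition talt := [seq t <- permutations tone | ~~ tinv t].

Lemma tab_Alt s : s \in 'Alt_('I_6) -> tab s \in talt.
Proof. by rewrite Alt_even mem_filter tinv_tab mem_permutations tab_perm => ->. Qed.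

Definition tpow (t : seq nat) n := iter n (tmul t) tone.

Lemma tabX s n : tab (s ^+ n) = tpow (tab s) n.
Proof. by elim: n => [|n IH]; rewrite ?expg0 ?tab1 // expgS tabM IH. Qed.
(** * The (2,3,5) triangle group has order at most 60 *)

Definition word := seq bool.
Definition rule := (word * word)%type.

Definition apply_rule (r : rule) (w : word) :=
  if take (size r.1) w == r.1 then Some (r.2 ++ drop (size r.1) w) else None.

Fixpoint apply_first (R : seq rule) (w : word) :=
  if R is r :: R' then
    if apply_rule r w is Some w' then Some w' else apply_first R' w
  else None.

Fixpoint reduce (R : seq rule) (w : word) :=
  if apply_first R w is Some w' then w'
  else if w is a :: w' then a :: reduce R w' else [::].

Section Words.

Variables (gT : finGroupType) (x s : gT).

Definition letter (b : bool) := if b then s else x.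
Definition weval (w : word) : gT := foldr (fun b g => letter b * g) 1 w.

Lemma weval_cat v w : weval (v ++ w) = weval v * weval w.
Proof. by elim: v => [|a v IH] /=; rewrite ?mul1g // IH mulgA. Qed.

Definition sound (R : seq rule) := {in R, forall r, weval r.1 = weval r.2}.

Lemma weval_apply_first R w w' : sound R -> apply_first R w = Some w' ->
  weval w' = weval w.
Proof.
elim: R => //= r R IH sR; rewrite /apply_rule.
case: eqP => [e [<-] | _]; last first.
  by apply: IH => r' Rr'; apply: sR; rewrite inE Rr' orbT.
by rewrite -[in RHS](cat_take_drop (size r.1) w) !weval_cat e sR ?mem_head.
Qed.

Lemma weval_reduce R w : sound R -> weval (reduce R w) = weval w.
Proof.
move=> sR; elim: w => [|a w IH] /=.
  by case e: apply_first => [w'|] //; apply: weval_apply_first e.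
by case e: apply_first => [w'|] /=; [apply: weval_apply_first e | rewrite IH].
Qed.

Lemma weval_iter_reduce R n w : sound R -> weval (iter n (reduce R) w) = weval w.
Proof. by move=> sR; elim: n => //= n IH; rewrite weval_reduce. Qed.

End Words.

(* A complete rewriting system for [<x, s | x^3, s^2, (x s)^5>] (Knuth-Bendix);
   it has 60 irreducible words.  The letter [true] stands for [s]. *)
Definition rules235 : seq rule :=
  let s := true in let x := false in
  [:: ([:: s; s], [::]);
      ([:: x; x; x], [::]);
      ([:: x; s; x; s; x; s], [:: s; x; x; s; x; x]);
      ([:: x; x; s; x; x; s], [:: s; x; s; x; s; x]);
      ([:: x; x; s; x; s; x; x; s; x; x],
       [:: s; x; s; x; s; x; x; s; x; s]);
      ([:: x; s; x; s; x; x; s; x; s; x],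
       [:: s; x; x; s; x; s; x; x; s]);
      ([:: x; s; x; x; s; x; s; x; x; s; x; s],
       [:: s; x; s; x; x; s; x; s; x; x; s; x])].

(** Words of length at most [n], grown one letter at a time: every prefix of an irreducible word is
    irreducible. *)
Fixpoint irreducible_words (n : nat) : seq word :=
  if n is n'.+1 then
    [::] :: [seq w <- [seq rcons v b | v <- irreducible_words n', b <- [:: true; false]]
              | reduce rules235 w == w]
  else [:: [::]].

Section Gen235.

Variables (gT : finGroupType) (x s : gT).
Hypotheses (s2 : s ^+ 2 = 1) (x3 : x ^+ 3 = 1) (xs5 : (x * s) ^+ 5 = 1).

(** The tail [g] in each equation lets it be applied inside a longer product. [r3] and [r4] split
    the relators (x s)^5 and (s x)^5 into two parts, and the longer rules follow from these two. *)
Lemma sound_rules235 : sound x s rules235.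
Proof.
have ss : s * s = 1 by [].
have ssK g : s * (s * g) = g by rewrite mulgA ss mul1g.
have xxx : x * (x * x) = 1 by exact: x3.
have xxxK g : x * (x * (x * g)) = g by rewrite !mulgA -(mulgA x) xxx mul1g.
have xV : x^-1 = x * x by apply/eqP; rewrite eq_invg_mul xxx.
have sV : s^-1 = s by apply/eqP; rewrite eq_invg_mul ss.
have r3 g : x * (s * (x * (s * (x * (s * g))))) = s * (x * (x * (s * (x * (x * g))))).
  suff e : (x * s) ^+ 3 = ((x * s) ^+ 2)^-1.
    move: e; rewrite !expgS expg0 !mulg1 !invMg sV xV => /(congr1 (mulg^~ g)).
    by rewrite !mulgA.
  by apply/eqP; rewrite eq_sym eq_invg_mul -expgD xs5.
have r4 g : x * (x * (s * (x * (x * (s * g))))) = s * (x * (s * (x * (s * (x * g))))).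
  have sx5 : (s * x) ^+ 5 = 1.
    have -> : s * x = (x * s) ^ s by rewrite /conjg sV -!mulgA ss mulg1.
    by rewrite -conjXg xs5 conj1g.
  suff e : ((s * x) ^+ 2)^-1 = (s * x) ^+ 3.
    move: e; rewrite !expgS expg0 !mulg1 !invMg sV xV => /(congr1 (mulg^~ g)).
    by rewrite -!mulgA.
  by apply/eqP; rewrite eq_invg_mul -expgD sx5.
have r5 g : x * (x * (s * (x * (s * (x * (x * (s * (x * (x * g))))))))) =
            s * (x * (s * (x * (s * (x * (x * (s * (x * (s * g))))))))).
  by rewrite -r3 r4.
have r6 g : x * (s * (x * (s * (x * (x * (s * (x * (s * (x * g))))))))) =
            s * (x * (x * (s * (x * (s * (x * (x * (s * g)))))))).
  by rewrite -[LHS]ssK -r5 xxxK.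
have r7 g : x * (s * (x * (x * (s * (x * (s * (x * (x * (s * (x * (s * g))))))))))) =
            s * (x * (s * (x * (x * (s * (x * (s * (x * (x * (s * (x * g))))))))))).
  by rewrite -[in LHS]r6 -[in LHS]r6 [in LHS]r4 [in LHS]r4 [in LHS]ssK.
move=> r; rewrite !inE => /or4P[|||/or4P[]] /eqP->.
- exact: ssK.
- exact: xxxK.
- exact: r3.
- exact: r4.
- exact: r5.
- exact: r6.
- exact: r7.
Qed.

(** The values of the irreducible words include 1 and are stable under right multiplication by both
    generators, so they contain the generated subgroup. *)
Lemma card_gen_235 : #|<<[set x; s]>>| <= 60.
Proof.
pose S := [set g in [seq weval x s w | w <- irreducible_words 12]].
have sR := sound_rules235.
have wr w b : weval x s (rcons w b) = weval x s w * letter x s b.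
  by rewrite -cats1 weval_cat /= mulg1.
have cl b : letter x s b \in 'N(S | 'R).
  apply/setIP; split; first by rewrite inE.
  rewrite inE; apply/subsetP=> g Sg; move: Sg; rewrite in_set => /mapP[w Lw ->].
  (* Two passes of [reduce] bring every one-letter extension back into the list, as the computation
     below confirms. *)
  rewrite in_set /= in_set -wr -(weval_iter_reduce 2 (rcons w b) sR); apply: map_f.
  have /allP/(_ w Lw)/allP : all (fun w => all (fun b =>
      iter 2 (reduce rules235) (rcons w b) \in irreducible_words 12)
      [:: true; false]) (irreducible_words 12) by vm_compute.
  by apply; case: b.
have sS : <<[set x; s]>> \subset 'N(S | 'R).
  by rewrite gen_subG; apply/subsetP=> g /set2P[]->;
    [apply: (cl false) | apply: (cl true)].
have S1 : 1 \in S by rewrite inE; apply/mapP; exists [::].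
apply: leq_trans (_ : #|S| <= 60).
  apply/subset_leq_card/subsetP=> g Hg; have Ng := subsetP sS g Hg.
  by rewrite -(astabs_act 1 Ng) /= mul1g in S1.
rewrite cardsE; apply: leq_trans (card_size _) _; rewrite size_map.
by vm_compute.
Qed.

End Gen235.
(** * Embedding criteria *)

Definition embeds_Alt6 (gT : finGroupType) (G : {group gT}) :=
  exists2 K : {group {perm 'I_6}}, K \subset 'Alt_('I_6) & G \isog K.

(** Right multiplication on the right cosets of [H] has kernel the core of [H]; the cosets are
    numbered to obtain permutations of ['I_n]. *)
Lemma isog_coset_perm (gT : finGroupType) (G H : {group gT}) n :
  H \subset G -> gcore H G = 1 -> #|G : H| = n ->
  exists K : {group {perm 'I_n}}, G \isog K.
Proof.
move=> sHG core1 <-.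
have HS : (H : {set gT}) \in rcosets H G.
  by apply/rcosetsP; exists 1; rewrite ?group1 ?rcoset1.
pose ev (i : 'I_#|G : H|) : {set gT} := enum_val i.
have Sg (g : [subg G]) i : ev i :* sgval g \in rcosets H G.
  have /rcosetsP[a Ga ea] : ev i \in rcosets H G := enum_valP i.
  rewrite ea.
  by apply/rcosetsP; exists (a * sgval g); rewrite ?rcosetM // groupM ?subgP.
pose f (g : [subg G]) (i : 'I_#|G : H|) : 'I_#|G : H| :=
  enum_rank_in HS (ev i :* sgval g).
have fE g i : ev (f g i) = ev i :* sgval g by rewrite /ev enum_rankK_in ?Sg.
have f_inj g : injective (f g).
  by move=> i j /(congr1 ev); rewrite !fE => /rcoset_inj/enum_val_inj.
pose phi g := perm (@f_inj g).
have phiM : {in [set: [subg G]] &, {morph phi : g h / g * h}}.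
  move=> g h _ _; apply/permP=> i; rewrite permM !permE; apply: enum_val_inj.
  by rewrite -/(ev _) -/(ev (f h _)) !fE rcosetM.
pose F := Morphism phiM.
have injF : 'injm F.
  apply/subsetP=> g /morphpreP[_ /set1P Fg]; rewrite inE -val_eqE /=.
  have : sgval g \in gcore H G.
    rewrite -astabRs_rcosets; apply/astabP=> A SA /=.
    have eA : ev (enum_rank_in HS A) = A by apply: enum_rankK_in.
    have ef : f g (enum_rank_in HS A) = enum_rank_in HS A.
      by rewrite -[LHS](permE (@f_inj g)) -/(phi g) [phi g]Fg perm1.
    by have /esym := fE g (enum_rank_in HS A); rewrite ef eA /= rcosetE.
  by rewrite core1 inE.
exists (F @* [set: [subg G]])%G; apply: isog_trans (isog_subg G) _.
exact: sub_isog.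
Qed.

Lemma isog_lift_perm (gT : finGroupType) (G : {group gT}) n (K : {group {perm 'I_n}}) :
  G \isog K -> exists K' : {group {perm 'I_n.+1}}, G \isog K'.
Proof.
move=> isoGK; pose f (s : {perm 'I_n}) := lift_perm ord_max ord_max s.
have fM : {in [set: {perm 'I_n}] &, {morph f : s t / s * t}}.
  by move=> s t _ _; rewrite /f lift_permM.
pose F := Morphism fM.
have injF : 'injm F.
  apply/injmP => s t _ _ /= e; apply/permP=> i; apply: (@lift_inj _ ord_max).
  by rewrite -(lift_perm_lift ord_max ord_max s) -(lift_perm_lift ord_max ord_max t)
    -/(f s) e.
exists (F @* K)%G; apply: isog_trans isoGK _; apply: sub_isog => //; exact: subsetT.
Qed.

Lemma isog_perm_le (gT : finGroupType) (G : {group gT}) n m (K : {group {perm 'I_n}}) :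
  G \isog K -> n <= m -> exists K' : {group {perm 'I_m}}, G \isog K'.
Proof.
move=> isoGK /subnK <-; elim: (m - n)%N => [|k [K' isoK']]; first by exists K.
exact: isog_lift_perm isoK'.
Qed.

(** Odd permutations of the four points also swap the two added points, which makes every image
    even. *)
Lemma embeds_perm4 (gT : finGroupType) (G : {group gT}) (K : {group {perm 'I_4}}) :
  G \isog K -> embeds_Alt6 G.
Proof.
move=> isoGK.
pose l (s : {perm 'I_4}) : {perm 'I_6} := lift_perm ord_max ord_max (lift_perm
  ord_max ord_max s).
pose i5 : 'I_6 := ord_max; pose i4 : 'I_6 := lift ord_max ord_max.
have l5 s : l s i5 = i5 by rewrite /l lift_perm_id.
have l4 s : l s i4 = i4 by rewrite /l lift_perm_lift lift_perm_id.
have oddl s : l s = s :> bool by rewrite !odd_lift_perm !addbb.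
have lM s t : l (s * t) = l s * l t by rewrite /l !lift_permM.
have linj : injective l.
  move=> s t e; apply/permP=> i; apply: (@lift_inj _ (ord_max : 'I_5)).
  apply: (@lift_inj _ (ord_max : 'I_6)).
  have lE (u : {perm 'I_4}) : lift ord_max (lift ord_max (u i)) = l u (lift ord_max
    (lift ord_max i)).
    by rewrite /l !lift_perm_lift.
  by rewrite !lE e.
pose t := tperm i4 i5.
have neq45 : i4 != i5 by [].
have tl s : commute t (l s).
  by apply/commgP/conjg_fixP; rewrite /t tpermJ l4 l5.
pose f (s : {perm 'I_4}) := l s * t ^+ (s : bool).
have fM : {in [set: {perm 'I_4}] &, {morph f : s u / s * u}}.
  move=> s u _ _; rewrite /f lM odd_permM.
  have ct : t ^+ (s : bool) * l u = l u * t ^+ (s : bool).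
    exact/commute_sym/commuteX/commute_sym/tl.
  rewrite -!mulgA (mulgA (t ^+ _)) ct -(mulgA (l u)) -expgD.
  by case: (s : bool); case: (u : bool); rewrite //= expg2 tperm2.
pose F := Morphism fM.
have injF : 'injm F.
  apply/subsetP=> s /morphpreP[_ /set1P Fs]; rewrite inE; apply/eqP.
  (* An odd [s] gives an image that moves [i5], so the kernel consists of even permutations, on
     which the map is [l]. *)
  move: Fs; rewrite /= /f; case: (s : bool) => [/permP/(_ i5)|]; last first.
    by rewrite expg0 mulg1 => ls1; apply: linj; rewrite ls1 /l !lift_perm1.
  by rewrite permM l5 expg1 tpermR perm1.
exists (F @* K)%G; last first.
  by apply: isog_trans isoGK _; apply: sub_isog => //; apply: subsetT.
apply/subsetP=> _ /morphimP[s _ _ ->]; rewrite Alt_even /= /f odd_permM oddl.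
by case: (s : bool); rewrite ?expg0 ?odd_perm1 // expg1 odd_tperm neq45.
Qed.

Lemma embeds_index_le4 (gT : finGroupType) (G H : {group gT}) :
  H \subset G -> gcore H G = 1 -> #|G : H| <= 4 -> embeds_Alt6 G.
Proof.
move=> sHG core1 le4; have [K isoGK] := isog_coset_perm sHG core1 (erefl _).
by have [K' /embeds_perm4] := isog_perm_le isoGK le4.
Qed.

(** If the image contained an odd permutation, its even permutations would form a subgroup of index
    2. *)
Lemma embeds_index6 (gT : finGroupType) (G H : {group gT}) :
  H \subset G -> gcore H G = 1 -> #|G : H| = 6 ->
  (forall K : {group gT}, K \subset G -> #|G : K| != 2) -> embeds_Alt6 G.
Proof.
move=> sHG core1 i6 no2; have [K isoGK] := isog_coset_perm sHG core1 i6.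
exists K => //; apply/idPn => nKA.
have /isogP[f injf fK] : K \isog G by rewrite isog_sym.
have sI : K :&: 'Alt_('I_6) \subset K := subsetIl _ _.
have := no2 (f @* (K :&: 'Alt_('I_6)))%G; rewrite -{1}fK morphimS // => /(_ isT).
rewrite -fK index_injm // indexgI eqn_leq indexg_gt1 nKA andbT => /negP[].
apply: leq_trans (_ : #|'Sym_('I_6) : 'Alt_('I_6)| <= 2); last first.
  by rewrite Alt_index ?card_ord.
by apply/subset_leq_card/imsetS/subsetP=> s _; rewrite inE.
Qed.

(** * Groups generated by two commuting elements and a third normalising them *)

(** [u] normalises the product of [<[p]>] and [<[q]>], so the generated group is a product of three
    cyclic groups of orders at most [a], [b] and [c]. *)
Lemma card_gen_metabelian (gT : finGroupType) (p q u : gT) (a b c i j k l : nat) :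
  0 < a -> 0 < b -> 0 < c ->
  p ^+ a = 1 -> q ^+ b = 1 -> u ^+ c = 1 -> commute p q ->
  p ^ u = p ^+ i * q ^+ j -> q ^ u = p ^+ k * q ^+ l ->
  #|<<[set p; q; u]>>| <= a * b * c.
Proof.
move=> a0 b0 c0 pa qb uc cpq pu qu.
have le x m : 0 < m -> x ^+ m = 1 -> #|<[x]>| <= m.
  by move=> m0 xm; rewrite -orderE dvdn_leq // order_dvdn xm.
have npq : <[q]> \subset 'N(<[p]>).
  by apply: cents_norm; apply: cents_cycle; apply: commute_sym.
have Wp : p \in <[p]> <*> <[q]> by rewrite mem_gen // inE cycle_id.
have Wq : q \in <[p]> <*> <[q]> by rewrite mem_gen // inE cycle_id orbT.
have nu : <[u]> \subset 'N(<[p]> <*> <[q]>).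
  rewrite cycle_subG inE; apply/subsetP=> x.
  have -> : <[p]> <*> <[q]> = <<[set p; q]>>.
    by rewrite joing_idl joing_idr.
  rewrite -genJ => Hx; apply: (subsetP _ _ Hx); rewrite gen_subG.
  apply/subsetP=> _ /imsetP[y /set2P[]-> ->].
    by rewrite pu groupM // groupX // mem_gen ?set21 ?set22.
  by rewrite qu groupM // groupX // mem_gen ?set21 ?set22.
have leM (A B : {group gT}) : #|A * B| <= #|A| * #|B|.
  by rewrite mul_cardG leq_pmulr.
apply: (@leq_trans #|<[p]> <*> <[q]> * <[u]>|).
  rewrite -norm_joinEr //; apply: subset_leq_card.
  rewrite gen_subG; apply/subsetP=> x; rewrite !inE -orbA.
  by case/or3P=> /eqP->; rewrite mem_gen // inE ?Wp ?Wq ?cycle_id ?orbT.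
apply: leq_trans (leM (<[p]> <*> <[q]>)%G <[u]>%G) _; apply: leq_mul; last exact: le.
rewrite /= norm_joinEr //; apply: leq_trans (leM <[p]>%G <[q]>%G) _.
by apply: leq_mul; apply: le.
Qed.

(* When [a * b] and [c] are coprime these relations present a group of order
   [a * b * c]; two such triples therefore generate isomorphic groups, as the
   subgroup generated by the pairs is the graph of an isomorphism. *)
Definition metabelian_triple (gT : finGroupType) (a b c i j k l : nat) (p q u : gT) :=
  [/\ [/\ #[p] = a, #[q] = b & #[u] = c], <[p]> :&: <[q]> = 1, commute p q,
      p ^ u = p ^+ i * q ^+ j & q ^ u = p ^+ k * q ^+ l].

(** The order is divisible by [a * b], the order of the product of [<[p]>] and [<[q]>], and by [c],
    which is coprime to it. *)
Lemma card_metabelian_triple (gT : finGroupType) (p q u : gT) a b c i j k l :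
  metabelian_triple a b c i j k l p q u -> coprime (a * b) c ->
  a * b * c <= #|<<[set p; q; u]>>|.
Proof.
case=> [[op oq ou] ti cpq _ _] co; apply: dvdn_leq => //.
have Wp : p \in <<[set p; q; u]>> by rewrite mem_gen // !inE eqxx.
have Wq : q \in <<[set p; q; u]>> by rewrite mem_gen // !inE eqxx orbT.
have Wu : u \in <<[set p; q; u]>> by rewrite mem_gen // !inE eqxx !orbT.
rewrite Gauss_dvd // -ou order_dvdG // andbT.
have <- : #|<[p]> <*> <[q]>| = (a * b)%N.
  by rewrite norm_joinEl ?cents_norm ?cents_cycle // TI_cardMg // -!orderE op oq.
by rewrite cardSg // join_subG !cycle_subG Wp.
Qed.

Lemma isog_metabelian_triple (gT rT : finGroupType) (G : {group gT})
    (p q u : gT) (p0 q0 u0 : rT) (a b c i j k l : nat) :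
  [/\ p \in G, q \in G & u \in G] ->
  metabelian_triple a b c i j k l p q u ->
  metabelian_triple a b c i j k l p0 q0 u0 ->
  coprime (a * b) c -> #|G| = (a * b * c)%N ->
  G \isog <<[set p0; q0; u0]>>.
Proof.
move=> [Gp Gq Gu] t t0 co oG.
have leH := card_metabelian_triple t co; have leK := card_metabelian_triple t0 co.
case: t t0 => [[op oq ou] _ cpq pu qu] [[op0 oq0 ou0] _ cpq0 pu0 qu0].
subst a b c.
have eG : <<[set p; q; u]>> = G.
  apply/eqP; rewrite eqEcard oG leH gen_subG andbT.
  by apply/subsetP=> x; rewrite !inE -orbA => /or3P[]/eqP->.
pose W := <<[set (p, p0); (q, q0); (u, u0)]>>%G.
have pairX (x : gT) (y : rT) n : (x, y) ^+ n = (x ^+ n, y ^+ n).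
  by elim: n => // n IH; rewrite !expgS IH.
(* The pairs satisfy the same relations, so [W] has at most the order of each projection, and both
   projections are injective. *)
have leW : #|W| <= #[p] * #[q] * #[u].
  apply: (card_gen_metabelian (i := i) (j := j) (k := k) (l := l));
    rewrite ?pairX ?order_gt0 //.
  - by rewrite expg_order -op0 expg_order.
  - by rewrite expg_order -oq0 expg_order.
  - by rewrite expg_order -ou0 expg_order.
  - by congr (_, _).
  - by congr (_, _).
  - by congr (_, _).
pose F1 := Morphism (D := [set: gT * rT]) (in2W (@fst_morphM gT rT)).
pose F2 := Morphism (D := [set: gT * rT]) (in2W (@snd_morphM gT rT)).
pose f1 := restrm (subsetT W) F1; pose f2 := restrm (subsetT W) F2.
have im1 : f1 @* W = G.
  rewrite morphim_restrm setIid morphim_gen ?subsetT // -eG morphimEsub ?subsetT //.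
  by rewrite !imsetU !imset_set1.
have im2 : f2 @* W = <<[set p0; q0; u0]>>.
  rewrite morphim_restrm setIid morphim_gen ?subsetT // morphimEsub ?subsetT //.
  by rewrite !imsetU !imset_set1.
have isoW (hT : finGroupType) (f : {morphism W >-> hT}) :
    #[p] * #[q] * #[u] <= #|f @* W| -> W \isog f @* W.
  move=> le; apply: sub_isog => //; rewrite -card_im_injm eqn_leq leq_morphim.
  exact: leq_trans leW le.
have iso1 : W \isog G by rewrite -im1; apply: isoW; rewrite im1 oG.
have iso2 : W \isog <<[set p0; q0; u0]>> by rewrite -im2; apply: isoW; rewrite im2.
by apply: isog_trans iso2; rewrite isog_sym.
Qed.

Lemma order_tab s n : prime n -> tab s != tone -> tpow (tab s) n == tone -> #[s] = n.
Proof.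
move=> pr_n n1 sn; apply/nt_prime_order => //.
  by apply: tab_inj; rewrite tabX tab1; apply/eqP.
by apply: contraNneq n1 => ->; rewrite tab1.
Qed.

Lemma order_eq4 (gT : finGroupType) (x : gT) : x ^+ 4 = 1 -> x ^+ 2 != 1 -> #[x] = 4.
Proof.
move/eqP; rewrite -!order_dvdn (dvdn_divisors #[x]) // !inE.
by case/or3P=> /eqP->.
Qed.

Lemma conjg_tab s t w : tmul (tab s) (tab t) == tmul (tab t) (tab w) -> s ^ t = w.
Proof.
by rewrite -!tabM => /eqP/tab_inj e; rewrite conjgE e mulKg.
Qed.

Lemma embeds_metabelian_triple (gT : finGroupType) (G : {group gT})
    (p q u : gT) (p0 q0 u0 : {perm 'I_6}) (a b c i j k l : nat) :
  [/\ p \in G, q \in G & u \in G] ->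
  metabelian_triple a b c i j k l p q u ->
  metabelian_triple a b c i j k l p0 q0 u0 ->
  coprime (a * b) c -> #|G| = (a * b * c)%N ->
  ~~ [|| tinv (tab p0), tinv (tab q0) | tinv (tab u0)] ->
  embeds_Alt6 G.
Proof.
move=> inG t t0 co oG; rewrite !tinv_tab !negb_or => /and3P[ep eq eu].
exists <<[set p0; q0; u0]>>%G; last exact: (isog_metabelian_triple inG t t0).
by rewrite gen_subG; apply/subsetP=> x /setUP[/set2P[]|/set1P]->; rewrite Alt_even.
Qed.

Lemma cycle_TI1 (gT : finGroupType) (x : gT) : <[x]> :&: <[1]> = 1.
Proof. by rewrite cycle1; apply/trivgP/subsetIr. Qed.

Lemma invg_expg_order (gT : finGroupType) (x : gT) n : #[x] = n.+1 -> x^-1 = x ^+ n.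
Proof. by move=> ox; apply/eqP; rewrite eq_invg_mul -expgS -ox expg_order. Qed.

(** * Explicit copies inside the alternating group of degree 6 *)

Lemma embeds_C5 (gT : finGroupType) (G : {group gT}) x :
  x \in G -> #[x] = 5 -> #|G| = 5 -> embeds_Alt6 G.
Proof.
move=> Gx ox oG; have [s ts] := @tab_surj [:: 1; 2; 3; 4; 0; 5]%N isT.
have os : #[s] = 5 by apply: order_tab; rewrite ?ts.
apply: (@embeds_metabelian_triple _ G x 1 1 s 1 1 5 1 1 1 0 0 0) => //.
- split; [by rewrite order1 | exact: cycle_TI1 | exact: commute1 | |].
    by rewrite conjg1 mulg1.
  by rewrite conjg1 mulg1.
- split; [by rewrite order1 | exact: cycle_TI1 | exact: commute1 | |].
    by rewrite conjg1 mulg1.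
  by rewrite conjg1 mulg1.
by rewrite tab1 ts.
Qed.

Lemma embeds_D10 (gT : finGroupType) (G : {group gT}) x t :
  x \in G -> t \in G -> #[x] = 5 -> #[t] = 2 -> x ^ t = x^-1 -> #|G| = 10 ->
  embeds_Alt6 G.
Proof.
move=> Gx Gt ox ot xt oG; have [s ts] := @tab_surj [:: 1; 2; 3; 4; 0; 5]%N isT.
have [r tr] := @tab_surj [:: 0; 4; 3; 2; 1; 5]%N isT.
have os : #[s] = 5 by apply: order_tab; rewrite ?ts.
have or : #[r] = 2 by apply: order_tab; rewrite ?tr.
apply: (@embeds_metabelian_triple _ G x 1 t s 1 r 5 1 2 4 0 0 0) => //.
- split; [by rewrite order1 | exact: cycle_TI1 | exact: commute1 | |].
    by rewrite mulg1 xt (invg_expg_order ox).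
  by rewrite conj1g mulg1.
- split; [by rewrite order1 | exact: cycle_TI1 | exact: commute1 | |].
    by rewrite mulg1; apply: conjg_tab; rewrite tabX ts tr.
  by rewrite conj1g mulg1.
by rewrite tab1 ts tr.
Qed.

Definition tc123 := [:: 1; 2; 0; 3; 4; 5]%N.
Definition tc456 := [:: 0; 1; 2; 4; 5; 3]%N.

Lemma C3C3_tab (p q : {perm 'I_6}) : tab p = tc123 -> tab q = tc456 ->
  [/\ #[p] = 3, #[q] = 3, <[p]> :&: <[q]> = 1 & commute p q].
Proof.
move=> tp tq; have op : #[p] = 3 by apply: order_tab; rewrite ?tp.
have oq : #[q] = 3 by apply: order_tab; rewrite ?tq.
split=> //; last by apply: tab_inj; rewrite !tabM tp tq.
apply: prime_TIg; rewrite -?orderE ?op // cycle_subG; apply/cycleP=> -[n].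
rewrite -(expg_mod_order q n) oq => /(congr1 tab); rewrite tabX tp tq.
by move: (ltn_pmod n (isT : 0 < 3)); case: (n %% 3)%N => [|[|[|]]].
Qed.

Section C3C3.

Variables (gT : finGroupType) (G : {group gT}) (p q : gT).
Hypotheses (Gp : p \in G) (Gq : q \in G) (op : #[p] = 3) (oq : #[q] = 3).
Hypotheses (nqp : q \notin <[p]>) (cpq : commute p q).

Let tiqp : <[p]> :&: <[q]> = 1.
Proof. by rewrite setIC prime_TIg -?orderE ?oq // cycle_subG. Qed.

Lemma embeds_C3C3 : #|G| = 9 -> embeds_Alt6 G.
Proof.
move=> oG; have [p0 tp] := @tab_surj tc123 isT; have [q0 tq] := @tab_surj tc456 isT.
have [op0 oq0 ti0 c0] := C3C3_tab tp tq.
apply: (@embeds_metabelian_triple _ G p q 1 p0 q0 1 3 3 1 1 0 0 1) => //.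
- by split; rewrite ?order1 ?conjg1 ?mulg1 ?mul1g.
- by split; rewrite ?order1 ?conjg1 ?mulg1 ?mul1g.
by rewrite tab1 tp tq.
Qed.

Lemma embeds_C3C3C2 u : u \in G -> #[u] = 2 -> p ^ u = p^-1 -> q ^ u = q^-1 ->
  #|G| = 18 -> embeds_Alt6 G.
Proof.
move=> Gu ou pu qu oG.
have [p0 tp] := @tab_surj tc123 isT; have [q0 tq] := @tab_surj tc456 isT.
(* [u0] is (0 1)(3 4), which inverts both 3-cycles. *)
have [u0 tu] := @tab_surj [:: 1; 0; 2; 4; 3; 5]%N isT.
have [op0 oq0 ti0 c0] := C3C3_tab tp tq.
have ou0 : #[u0] = 2 by apply: order_tab; rewrite ?tu.
apply: (@embeds_metabelian_triple _ G p q u p0 q0 u0 3 3 2 2 0 0 2) => //.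
- by split; rewrite // ?mulg1 ?mul1g ?pu ?qu; apply: invg_expg_order.
- split; rewrite // ?mulg1 ?mul1g; apply: conjg_tab; rewrite tabX ?tp ?tq tu //.
by rewrite tp tq tu.
Qed.

Lemma embeds_C3C3C4 u : u \in G -> #[u] = 4 -> p ^ u = q -> q ^ u = p^-1 ->
  #|G| = 36 -> embeds_Alt6 G.
Proof.
move=> Gu ou pu qu oG.
have [p0 tp] := @tab_surj tc123 isT; have [q0 tq] := @tab_surj tc456 isT.
(* [u0] is (0 3)(1 4 2 5): it takes the first 3-cycle to the second and the second to the inverse of
   the first. *)
have [u0 tu] := @tab_surj [:: 3; 4; 5; 0; 2; 1]%N isT.
have [op0 oq0 ti0 c0] := C3C3_tab tp tq.
have ou0 : #[u0] = 4.
  apply: order_eq4; first by apply: tab_inj; rewrite tabX tab1 tu.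
  by apply/eqP => /(congr1 tab); rewrite tabX tab1 tu.
apply: (@embeds_metabelian_triple _ G p q u p0 q0 u0 3 3 4 0 1 2 0) => //.
- by split; rewrite // ?mulg1 ?mul1g ?pu ?qu //; apply: invg_expg_order.
- split; rewrite // ?mulg1 ?mul1g; apply: conjg_tab; rewrite ?tabX ?tp ?tq tu //.
by rewrite tp tq tu.
Qed.

End C3C3.
(** * Groups with the local structure of the alternating group *)

(** What the identities (2) to (7) give in terms of orders and subgroups. In [a6_frob20], an element
    of order 4 acting on one of order 5 as squaring would generate with it the Frobenius group of
    order 20. *)
Record a6_like (gT : finGroupType) (G : {group gT}) : Prop := A6Like {
  a6_order : forall x, x \in G -> [\/ x ^+ 3 = 1, x ^+ 4 = 1 | x ^+ 5 = 1];
  a6_2abelem : forall T : {group gT}, T \subset G -> 2.-abelem T -> #|T| %| 4;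
  a6_cycle4 : forall (T : {group gT}) x y, T \subset G -> 2.-group T ->
    x \in T -> y \in T -> #[x] = 4 -> #[y] = 4 -> y \in <[x]>;
  a6_3group : forall T : {group gT}, T \subset G -> 3.-group T -> #|T| %| 9;
  a6_5group : forall T : {group gT}, T \subset G -> 5.-group T -> #|T| %| 5;
  a6_frob20 : forall x y, x \in G -> y \in G -> #[x] = 5 -> #[y] = 4 ->
    x ^ y != x ^+ 2 }.

Section Local.

Variable gT : finGroupType.
Implicit Types (G H K P Q T : {group gT}) (x y z : gT) (p q : nat).

Lemma a6_likeS G H : a6_like G -> H \subset G -> a6_like H.
Proof.
case=> o e c s f n sHG; split.
- by move=> x /(subsetP sHG)/o.
- by move=> T /subset_trans/(_ sHG)/e.
- by move=> T x y /subset_trans/(_ sHG)/c; apply.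
- by move=> T /subset_trans/(_ sHG)/s.
- by move=> T /subset_trans/(_ sHG)/f.
- by move=> x y /(subsetP sHG) Gx /(subsetP sHG); apply: n.
Qed.

Lemma a6_order_le5 G x : a6_like G -> x \in G -> #[x] <= 5.
Proof.
move=> aG /(a6_order aG)[] /eqP; rewrite -order_dvdn => /dvdn_leq; lia.
Qed.

(** Commuting elements of coprime orders have a product whose order is the product of the orders;
    two coprime orders above 1 give at least 6, while 5 is the maximum. *)
Lemma a6_commute G x y : a6_like G -> x \in G -> y \in G ->
  commute x y -> coprime #[x] #[y] -> x = 1 \/ y = 1.
Proof.
move=> aG Gx Gy cxy co; have := a6_order_le5 aG (groupM Gx Gy).
rewrite orderM //; have := order_gt0 x; have := order_gt0 y.
case: (eqVneq #[x] 1%N) => [/eqP|nx]; first by rewrite order_eq1 => /eqP; left.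
case: (eqVneq #[y] 1%N) => [/eqP|ny]; first by rewrite order_eq1 => /eqP; right.
move: #[x] #[y] co nx ny => [|[|[|a]]] [|[|[|b]]] //; nia.
Qed.

Lemma a6_cent_pgroup G p x : a6_like G -> x \in G -> x != 1 -> p.-elt x ->
  p.-group 'C_G[x].
Proof.
move=> aG Gx ntx px; apply/pgroupP=> q q_pr /(Cauchy q_pr)[y].
case/setIP=> Gy /cent1P cxy oy; apply/idPn=> npq.
have co : coprime #[x] #[y] by apply: pnat_coprime px _; rewrite oy pnatE.
have [/eqP | y1] := a6_commute aG Gx Gy (esym cxy) co; first by rewrite (negPf ntx).
by move: q_pr; rewrite -oy y1 order1.
Qed.

Lemma a6_sylow_abelian G p P : a6_like G -> p.-Sylow(G) P -> odd p -> abelian P.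
Proof.
move=> aG sylP podd; have pP := pHall_pgroup sylP.
have [-> | ntP] := eqVneq P 1%G; first exact: abelian1.
have [p_pr p_dv _] := pgroup_pdiv pP ntP.
have sPG := pHall_sub sylP.
apply: (p2group_abelian pP).
have [x Px ox] := Cauchy p_pr p_dv.
have := a6_order_le5 aG (subsetP sPG _ Px); rewrite ox => p5.
have {p5 p_pr podd} : p \in [:: 3; 5].
  by move: p p_pr podd p5 {sylP pP p_dv ox} => [|[|[|[|[|[|p]]]]]].
rewrite !inE => /orP[] /eqP ep; rewrite {}ep in pP *.
  by have /(dvdn_leq_log 3)-> := a6_3group aG sPG pP.
by have /(dvdn_leq_log 5)/leq_trans-> := a6_5group aG sPG pP.
Qed.

(** [P] is abelian, so it lies in the centraliser, which is a [p]-group and cannot be larger. *)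
Lemma a6_sylow_cent G p P x : a6_like G -> p.-Sylow(G) P -> odd p ->
  x \in P -> x != 1 -> 'C_G[x] = P.
Proof.
move=> aG sylP podd Px ntx; have sPG := pHall_sub sylP.
apply: (sub_pHall sylP) (subsetIl _ _).
  by apply: a6_cent_pgroup => //; [apply: (subsetP sPG) | apply: mem_p_elt Px;
    apply: pHall_pgroup sylP].
by rewrite subsetI sPG sub_cent1 (subsetP (a6_sylow_abelian aG sylP podd)).
Qed.

Lemma a6_sylow_TI G p P Q x : a6_like G -> p.-Sylow(G) P -> p.-Sylow(G) Q ->
  odd p -> x \in P -> x \in Q -> x != 1 -> P :=: Q.
Proof.
move=> aG sylP sylQ podd Px Qx ntx.
by rewrite -(a6_sylow_cent aG sylP podd Px ntx) (a6_sylow_cent aG sylQ).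
Qed.

(** Distinct Sylow subgroups for an odd prime meet trivially; in this form their nontrivial elements
    can be counted. *)
Lemma a6_sylow_normedTI G p P : a6_like G -> p.-Sylow(G) P -> odd p ->
  P :!=: 1 -> normedTI P^# G 'N_G(P).
Proof.
move=> aG sylP podd ntP; apply/normedTI_memJ_P; split.
- by rewrite setD_eq0 subG1.
- exact: subsetIl.
move=> a g /setD1P[nta Pa] Gg; rewrite in_setD1 conjg_eq1 nta /=.
apply/idP/idP => [Pag | /setIP[_ nPg]]; last by rewrite memJ_norm.
have sylPg : p.-Sylow(G) (P :^ g)%G by rewrite /= pHallJ.
rewrite inE Gg /=; apply/normP/esym.
by apply: (a6_sylow_TI (x := a ^ g) aG sylP sylPg); rewrite ?memJ_conjg ?conjg_eq1.
Qed.

(** [K] and [P] normalise each other and meet trivially, so they commute; elements of coprime orders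
    commute only if one is trivial. *)
Lemma a6_normal_p'_cent G p P K : a6_like G -> p.-Sylow(G) P -> P :!=: 1 ->
  K <| G -> K \subset 'N(P) -> p^'.-group K -> K :=: 1.
Proof.
move=> aG sylP ntP /andP[sKG nKG] nPK p'K.
have pP := pHall_pgroup sylP; have sPG := pHall_sub sylP.
have tiKP : P :&: K = 1 by apply: coprime_TIg; apply: pnat_coprime pP p'K.
have cPK : K \subset 'C(P).
  apply/commG1P/trivgP; rewrite -tiKP subsetI commg_subr nPK.
  by rewrite commg_subl (subset_trans sPG).
apply/trivgP/subsetP=> k Kk; have [x Px ntx] := trivgPn _ ntP.
have [||->|/eqP] := a6_commute aG (subsetP sKG k Kk) (subsetP sPG x Px).
- exact: (centsP cPK).
- rewrite coprime_sym; apply: pnat_coprime (mem_p_elt pP Px) (mem_p_elt p'K Kk).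
- by rewrite group1.
by rewrite (negPf ntx).
Qed.

Lemma a6_2elt_order G x : a6_like G -> x \in G -> 2.-elt x ->
  #[x] \in [:: 1; 2; 4]%N.
Proof.
move=> aG Gx /p_natP[k ox]; have := a6_order_le5 aG Gx; rewrite ox.
by case: k {ox} => [|[|[|k]]] //; rewrite !expnS; have := expn_gt0 2 k; lia.
Qed.

(** Elements of order 4 all lie in [<[x]>], so [t] is an involution. If it commuted with [x], then
    [x * t] would have order 4 and lie in [<[x]>] too. *)
Lemma a6_notin_cycle4 G T x t : a6_like G -> T \subset G -> 2.-group T ->
  x \in T -> t \in T -> #[x] = 4 -> t \notin <[x]> ->
  #[t] = 2 /\ x ^ t != x.
Proof.
move=> aG sTG pT Tx Tt ox nxt.
have ot : #[t] = 2.
  have := a6_2elt_order aG (subsetP sTG t Tt) (mem_p_elt pT Tt).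
  rewrite !inE order_eq1 => /or3P[/eqP t1 | /eqP // | /eqP o4].
    by rewrite t1 group1 in nxt.
  by rewrite (a6_cycle4 aG sTG pT Tx Tt ox o4) in nxt.
split=> //; apply/negP=> /eqP/conjg_fixP/commgP cxt.
have := a6_2elt_order aG (subsetP sTG _ (groupM Tx Tt)) (mem_p_elt pT (groupM Tx Tt)).
have t2 : t ^+ 2 = 1 by rewrite -ot expg_order.
have xt2 : (x * t) ^+ 2 = x ^+ 2 by rewrite expgMn // t2 mulg1.
have nx2 : x ^+ 2 != 1 by rewrite -order_dvdn ox.
rewrite !inE => /or3P[|/eqP o2|/eqP o4].
- by rewrite order_eq1 => /eqP xt1; rewrite -xt2 xt1 expg1n eqxx in nx2.
- by rewrite -xt2 -o2 expg_order eqxx in nx2.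
have := a6_cycle4 aG sTG pT Tx (groupM Tx Tt) ox o4.
by rewrite groupMl ?cycle_id // (negPf nxt).
Qed.

Lemma a6_2group_abelem G : a6_like G -> 2.-group G ->
  (forall x, x \in G -> #[x] != 4) -> 2.-abelem G.
Proof.
move=> aG pG n4; have [-> | ntG] := eqVneq G 1%G; first exact: abelem1.
have sq1 x : x \in G -> x ^+ 2 = 1.
  move=> Gx; have := a6_2elt_order aG Gx (mem_p_elt pG Gx).
  rewrite !inE (negPf (n4 x Gx)) orbF => /orP[/eqP/(congr1 (dvdn^~ 2)) | /eqP o2].
    by rewrite order_dvdn => /eqP.
  by rewrite -o2 expg_order.
rewrite abelemE //; apply/andP; split; last exact/exponentP.
apply/centsP=> x Gx y Gy; rewrite /commute.
have iv z : z \in G -> z = z^-1 by move=> /sq1 z2; apply/eqP;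
  rewrite eq_sym eq_invg_mul; apply/eqP.
by rewrite (iv (x * y)) ?groupM // invMg -!iv.
Qed.

(** Without elements of order 4 the group is elementary abelian. Otherwise an element [c] of order 4
    is conjugate at most to itself and its inverse and is centralised only by [<[c]>], so the order
    is at most twice 4. *)
Lemma a6_2group G T : a6_like G -> T \subset G -> 2.-group T -> #|T| %| 8.
Proof.
move=> aG sTG pT; have aT := a6_likeS aG sTG.
case: (pickP [pred c in T | #[c] == 4]) => [c /andP[Tc /eqP oc]|n4]; last first.
  apply: (@dvdn_trans 4) => //; apply: (a6_2abelem aG sTG).
  by apply: (a6_2group_abelem aT pT) => x Tx; have := n4 x; rewrite /= Tx => /negbT.
have sCT : c ^: T \subset [set c; c^-1].
  apply/subsetP=> _ /imsetP[t Tt ->].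
  have : c ^ t \in <[c]> by apply: (a6_cycle4 aG sTG pT) => //; rewrite ?groupJ ?orderJ.
  case/cycleP=> k; rewrite -(expg_mod_order c k) oc => ect.
  have := orderJ c t; rewrite ect oc; move: (ltn_pmod k (isT : 0 < 4)).
  case: (k %% 4)%N => [|[|[|[|]]]] // _; rewrite ?order1 ?expg1 ?set21 //.
    by rewrite orderXdiv oc.
  by rewrite -(invg_expg_order oc) set22.
have cC : 'C_T[c] \subset <[c]>.
  apply/subsetP=> t /setIP[Tt /cent1P cct]; apply/idPn => nct.
  have [_ /eqP[]] := a6_notin_cycle4 aT (subxx _) pT Tc Tt oc nct.
  exact/conjg_fixP/commgP.
have eC : 'C_T[c] = <[c]>.
  by apply/eqP; rewrite eqEsubset cC cycle_subG; apply/setIP; split=> //; apply/cent1P.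
have sT : <[c]> \subset T by rewrite cycle_subG.
have : #|T : <[c]>| <= 2.
  rewrite -eC index_cent1 (leq_trans (subset_leq_card sCT)) // cards2.
  by case: (_ != _).
rewrite -(Lagrange sT) -orderE oc.
by have := indexg_gt0 T <[c]>; case: #|T : _| => [|[|[|]]].
Qed.

Lemma a6_card_dvdn G : a6_like G -> #|G| %| 360.
Proof.
move=> aG; apply/dvdn_partP=> // p; rewrite mem_primes => /and3P[p_pr _ pG].
have [P sylP] := Sylow_exists p G; rewrite -(card_Hall sylP).
have [sPG pP] := (pHall_sub sylP, pHall_pgroup sylP).
have [x Gx ox] := Cauchy p_pr pG; have := a6_order_le5 aG Gx; rewrite ox => p5.
have: p \in [:: 2; 3; 5].
  by move: p p_pr p5 {sylP pG pP ox} => [|[|[|[|[|[|p]]]]]].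
rewrite !inE => /or3P[] /eqP ep; rewrite {}ep in pP.
- exact: dvdn_trans (a6_2group aG sPG pP) _.
- exact: dvdn_trans (a6_3group aG sPG pP) _.
- exact: dvdn_trans (a6_5group aG sPG pP) _.
Qed.

(** Under conjugation by [y] the only fixed point is 1, since other elements of [K] have order prime
    to 5 and cannot commute with [y]. *)
Lemma a6_fix5 G K y : a6_like G -> K \subset G -> y \in G -> #[y] = 5 ->
  y \in 'N(K) -> coprime 5 #|K| -> #|K| = 1 %[mod 5].
Proof.
move=> aG sKG Gy oy nKy co.
have y5 : 5.-group <[y]> by rewrite /pgroup -orderE oy.
have acts : [acts <[y]>, on K | 'J] by rewrite astabsJ cycle_subG.
rewrite (pgroup_fix_mod y5 acts) afixJ.
suff -> : K :&: 'C(<[y]>) = 1 by rewrite cards1.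
apply/eqP; rewrite -subG1; apply/subsetP=> k /setIP[Kk /centP cyk].
have [||->|y1] := a6_commute aG (subsetP sKG k Kk) Gy; rewrite ?inE //.
- by apply: cyk; apply: cycle_id.
- by rewrite oy coprime_sym (coprime_dvdr (order_dvdG Kk)).
by rewrite y1 order1 in oy.
Qed.

End Local.

(** * 2-groups, and 2-subgroups normalising a 3-subgroup *)

Section Case23.

Variable gT : finGroupType.
Implicit Types (G H K P Q T : {group gT}) (x y z : gT) (p q : nat).

(** Up to order 4 the regular action serves. In order 8 an involution [t] outside a cyclic subgroup
    of order 4 is not central, so [<[t]>] has trivial core and index 4. *)
Lemma embeds_2group G : a6_like G -> 2.-group G -> embeds_Alt6 G.
Proof.
move=> aG pG; have [le4 | gt4] := leqP #|G| 4.
  apply: (embeds_index_le4 (H := 1%G)); rewrite ?sub1G ?indexg1 //.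
  by apply/trivgP; apply: gcore_sub.
have o8 : #|G| = 8.
  apply/eqP; have := a6_2group aG (subxx _) pG; rewrite dvdn_divisors // !inE.
  by case/or4P=> /eqP eG; rewrite eG in gt4 *.
have [c /andP[Gc /eqP oc]] : exists c, (c \in G) && (#[c] == 4).
  apply/existsP; apply: contraLR gt4; rewrite negb_exists => /forallP n4.
  rewrite -leqNgt; apply/dvdn_leq => //; apply: (a6_2abelem aG (subxx _)).
  by apply: (a6_2group_abelem aG pG) => x Gx; have := n4 x; rewrite Gx.
have [t Gt nct] : exists2 t, t \in G & t \notin <[c]>.
  by apply/subsetPn; apply: contraTN gt4 => /subset_leq_card;
    rewrite -orderE oc -leqNgt.
have [ot ntc] := a6_notin_cycle4 aG (subxx _) pG Gc Gt oc nct.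
have sTG : <[t]> \subset G by rewrite cycle_subG.
apply: (embeds_index_le4 sTG).
  apply/eqP; apply: contraR ntc => ntK.
  have sK := gcore_sub <[t]> G; have nK := gcore_norm <[t]> G.
  have pr_t : prime #|<[t]>| by rewrite -orderE ot.
  have eK : gcore <[t]> G = <[t]>.
    apply/eqP; rewrite eqEsubset sK /=.
    by have [// | /=] := prime_subgroupVti [group of gcore <[t]> G] pr_t;
      rewrite (setIidPl sK) => K1; rewrite K1 eqxx in ntK.
  have : t ^ c \in <[t]> by rewrite -eK memJ_norm ?(subsetP nK) // eK cycle_id.
  rewrite cycle2g // !inE conjg_eq1 -order_eq1 ot /= => /eqP/conjg_fixP/commgP ctc.
  by apply/eqP/conjg_fixP/commgP.
by rewrite -divgS // o8 -orderE ot.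
Qed.

(** [x * x ^ t] is fixed by [t], hence trivial, as its order is odd. *)
Lemma a6_involution_inverts G P x t : a6_like G -> P \subset G -> 3.-group P ->
  abelian P -> t \in G -> #[t] = 2 -> t \in 'N(P) -> x \in P -> x ^ t = x^-1.
Proof.
move=> aG sPG pP abP Gt ot nPt Px; have Pxt : x ^ t \in P by rewrite memJ_norm.
have t2 : t * t = 1 by rewrite -expg2 -ot expg_order.
have cyt : commute (x * x ^ t) t.
  apply/commgP/conjg_fixP; rewrite conjMg -conjgM t2 conjg1.
  exact: (centsP abP).
have Pxx := groupM Px Pxt.
have [|xx1|t1] := a6_commute aG (subsetP sPG _ Pxx) Gt cyt.
- by rewrite ot; apply: (pnat_coprime (pi := 3)); [apply: mem_p_elt pP Pxx | ].
- by apply/eqP; rewrite eq_sym eq_invg_mul xx1.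
by rewrite t1 order1 in ot.
Qed.

(** Two involutions of [Q] both invert [P], so their product centralises [P] and is trivial. Thus
    [Q] has at most one involution, and an element outside a cyclic subgroup of order 4 would be a
    second one. *)
Lemma a6_norm3_cyclic G P Q : a6_like G -> P \subset G -> 3.-group P ->
  abelian P -> P :!=: 1 -> Q \subset G -> 2.-group Q -> Q \subset 'N(P) ->
  cyclic Q.
Proof.
move=> aG sPG pP abP ntP sQG pQ nPQ.
have [x Px ntx] := trivgPn _ ntP.
have inv_eq t s : t \in Q -> s \in Q -> #[t] = 2 -> #[s] = 2 -> t = s.
  move=> Qt Qs ot os; have [Gx Gt Gs] := And3 (subsetP sPG x Px) (subsetP sQG t Qt)
    (subsetP sQG s Qs).
  have e1 := a6_involution_inverts aG sPG pP abP Gt ot (subsetP nPQ t Qt) Px.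
  have e2 := a6_involution_inverts aG sPG pP abP Gs os (subsetP nPQ s Qs) Px.
  have cxts : commute x (t * s).
    by apply/commgP/conjg_fixP; rewrite conjgM e1 conjVg e2 invgK.
  have [|x1|ts1] := a6_commute aG Gx (groupM Gt Gs) cxts.
  - apply: (pnat_coprime (pi := 3)); first exact: mem_p_elt pP Px.
    by apply: (@sub_in_pnat 2) (mem_p_elt pQ (groupM Qt Qs)) => r _ /eqP->.
  - by rewrite x1 eqxx in ntx.
  by apply/eqP; rewrite eq_mulgV1 -(eqP (_ : s == s^-1)) ?ts1 // eq_sym eq_invg_mul
    -expg2 -os expg_order.
case: (pickP [pred c in Q | #[c] == 4]) => [c /andP[Qc /eqP oc] | n4].
  suff -> : Q :=: <[c]> by apply: cycle_cyclic.
  apply/eqP; rewrite eqEsubset cycle_subG Qc andbT; apply/subsetP=> t Qt.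
  apply/idPn=> nct; have [ot _] := a6_notin_cycle4 aG sQG pQ Qc Qt oc nct.
  have oc2 : #[c ^+ 2] = 2 by rewrite orderXdiv oc.
  by rewrite (inv_eq t (c ^+ 2)) ?groupX ?cycle_id in nct.
have [-> | ntQ] := eqVneq Q 1%G; first exact: cyclic1.
have [_ /(Cauchy _)[] // t Qt ot _] := pgroup_pdiv pQ ntQ.
suff -> : Q :=: <[t]> by apply: cycle_cyclic.
apply/eqP; rewrite eqEsubset cycle_subG Qt andbT; apply/subsetP=> s Qs.
have := a6_2elt_order aG (subsetP sQG s Qs) (mem_p_elt pQ Qs).
have := n4 s; rewrite !inE Qs /= order_eq1 => -> /or3P[/eqP-> | /eqP os |//].
  exact: group1.
by rewrite (inv_eq s t) ?cycle_id.
Qed.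
End Case23.

(** * Groups of order prime to 5 *)

Lemma part23_dvd72 n : n %| 72 -> (n`_2 * n`_3)%N = n.
Proof.
have /allP h : all (fun n => 2 ^ logn 2 n * 3 ^ logn 3 n == n)%N (divisors 72) by
  vm_compute.
by rewrite !p_part dvdn_divisors // => /h/eqP.
Qed.

Lemma dvdn72 n : n %| 360 -> ~~ (5 %| n) -> n %| 72.
Proof.
move=> dn n5; rewrite -(@Gauss_dvdr n 5) //.
by rewrite coprime_sym prime_coprime.
Qed.

Section Case3.

Variable gT : finGroupType.
Implicit Types (G H K P Q T : {group gT}) (x y z : gT) (p q : nat).

Lemma a6_3elt_order G x : a6_like G -> x \in G -> 3.-elt x -> x != 1 -> #[x] = 3.
Proof.
move=> aG Gx /p_natP[k ok] ntx; have := a6_order_le5 aG Gx; rewrite ok => le5.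
have k1 : k < 2 by rewrite -(@ltn_exp2l 3) // (leq_ltn_trans le5).
by case: k k1 ok {le5} => [|[|]] // _ /eqP; rewrite order_eq1 (negPf ntx).
Qed.

(** The action on the four Sylow 3-subgroups is faithful: an element of order 3 in the kernel would
    lie in two of them, so the kernel has order prime to 3 and normalises [P], hence is trivial. *)
Lemma embeds_sylow3_4 G P : a6_like G -> 3.-Sylow(G) P -> P :!=: 1 ->
  #|G : 'N_G(P)| = 4 -> embeds_Alt6 G.
Proof.
move=> aG sylP ntP i4; have [sPG pP] := (pHall_sub sylP, pHall_pgroup sylP).
apply: (@embeds_index_le4 _ _ ('N_G(P))%G); rewrite ?subsetIl ?i4 //=.
have sKN : gcore 'N_G(P) G \subset 'N_G(P) := gcore_sub _ _.
have nK : gcore 'N_G(P) G <| G by rewrite gcore_normal ?subsetIl.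
apply: (@a6_normal_p'_cent _ G 3 P (gcore_group 'N_G(P) G)) => //=.
  by apply: subset_trans sKN (subsetIr _ _).
apply/pgroupP=> r r_pr /(Cauchy r_pr)[x Kx ox] /=; apply/negP=> /eqP r3.
have inP z : z \in gcore 'N_G(P) G -> #[z] = 3 -> z \in P.
  move=> Kz oz; have sylPN : 3.-Sylow('N_G(P)) P.
    by apply: pHall_subl sylP; rewrite ?subsetIl // subsetI sPG normG.
  rewrite (mem_normal_Hall sylPN) ?normalSG ?(subsetP sKN) //.
  by rewrite /p_elt oz.
have: #|G : 'N_G(P)| != 1%N by rewrite i4.
rewrite indexg_eq1 subsetI subxx /= => /subsetPn[g Gg] /normP[].
have sylPg : 3.-Sylow(G) (P :^ g)%G by rewrite /= pHallJ.
apply/esym; apply: (@a6_sylow_TI _ G 3 P (P :^ g)%G x) => //=.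
- by apply: inP => //; rewrite ox.
- by rewrite mem_conjg inP ?orderJ ?ox // memJ_norm // groupV (subsetP (normal_norm
  nK)).
by rewrite -order_eq1 ox r3.
Qed.

(** [G] is [P] extended by the cyclic 2-group [Q]. If [P] has order 3, the cosets of [Q] serve; if
    it has order 9, involutions invert it and the order of a generator [u] of [Q] determines the
    group. *)
Lemma embeds_sylow3_normal G P : a6_like G -> 3.-Sylow(G) P -> P :!=: 1 ->
  P <| G -> ~~ (5 %| #|G|) -> embeds_Alt6 G.
Proof.
move=> aG sylP ntP nPG n5; have [sPG pP] := (pHall_sub sylP, pHall_pgroup sylP).
have [Q sylQ] := Sylow_exists 2 G.
have [sQG pQ] := (pHall_sub sylQ, pHall_pgroup sylQ).
have oG : (#|Q| * #|P|)%N = #|G|.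
  rewrite (card_Hall sylQ) (card_Hall sylP) part23_dvd72 //.
  by rewrite dvdn72 ?a6_card_dvdn.
have nPQ : Q \subset 'N(P) := subset_trans sQG (normal_norm nPG).
have abP := a6_sylow_abelian aG sylP isT.
have cycQ := a6_norm3_cyclic aG sPG pP abP ntP sQG pQ nPQ.
have ordP x : x \in P -> x != 1 -> #[x] = 3.
  by move=> Px; apply: (a6_3elt_order aG); [apply: (subsetP sPG) | apply: mem_p_elt Px].
have coreQ : gcore Q G = 1.
  apply: (@a6_normal_p'_cent _ G 3 P (gcore_group Q G)) => //=.
  - by rewrite gcore_normal.
  - exact: subset_trans (gcore_sub _ _) nPQ.
  apply: pgroupS (gcore_sub _ _) _.
  by apply: sub_in_pnat pQ => r _ /eqP->.
have := a6_3group aG sPG pP; rewrite dvdn_divisors // !inE => /or3P[] /eqP oP.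
- by rewrite -cardG_gt1 oP in ntP.
- by apply: (embeds_index_le4 sQG); rewrite // -divgS // -oG oP mulKn.
have [p Pp ntp] := trivgPn _ ntP; have op := ordP p Pp ntp.
have Gp := subsetP sPG p Pp.
have cPP x y : x \in P -> y \in P -> commute x y by move=> Px Py; apply: (centsP abP).
case/cyclicP: cycQ => u eQ; rewrite eQ -orderE oP in oG.
have Qu : u \in Q by rewrite eQ cycle_id.
have Gu := subsetP sQG u Qu; have nPu := subsetP nPQ u Qu.
have [q0 Pq0 nq0] : exists2 q, q \in P & q \notin <[p]>.
  by apply/subsetPn/negP => /subset_leq_card; rewrite oP -orderE op.
have Gq0 := subsetP sPG q0 Pq0.
have oq0 : #[q0] = 3 by apply: ordP => //; apply: contraNneq nq0 => ->.
have inv x v : x \in P -> v \in Q -> #[v] = 2 -> x ^ v = x^-1.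
  move=> Px Qv ov; apply: (a6_involution_inverts aG sPG pP abP) => //.
    exact: (subsetP sQG).
  exact: (subsetP nPQ).
have := a6_2elt_order aG Gu (mem_p_elt pQ Qu); rewrite !inE => /or3P[]/eqP ou.
- by apply: (embeds_C3C3 Gp Gq0 op oq0 nq0); [exact: cPP | rewrite -oG ou].
- by apply: (embeds_C3C3C2 Gp Gq0 op oq0 nq0 (cPP _ _ Pp Pq0) Gu ou);
  [exact: inv | exact: inv | rewrite -oG ou].
have u2 : #[u ^+ 2] = 2 by rewrite orderXdiv ou.
have eqq : (p ^ u) ^ u = p^-1 by rewrite -conjgM -(inv p (u ^+ 2)) ?groupX.
have ppV : p != p^-1 by rewrite eq_sym eq_invg_mul -expg2 -order_dvdn op.
have Ppu : p ^ u \in P by rewrite memJ_norm.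
have npu : p ^ u \notin <[p]>.
  (* [p ^ u = p ^+ k] would make [k * k] equal to -1 modulo 3, which has no solution. *)
  apply/cycleP => -[k epu].
  have : p ^+ (k * k) = p^-1 by rewrite expgM -epu -conjXg -epu.
  rewrite -(expg_mod_order _ (k * k)) -modnMm op; move: (ltn_pmod k (isT : 0 < 3)).
  case: (k %% 3)%N => [|[|[|]]] // _; rewrite /= ?expg1 ?expg0 => e1.
  - by move/eqP: e1; rewrite eq_sym -order_eq1 orderV op.
  - by rewrite -e1 eqxx in ppV.
  - by rewrite -e1 eqxx in ppV.
apply: (embeds_C3C3C4 Gp (groupJ Gp Gu) op _ npu (cPP _ _ Pp Ppu) Gu ou) => //.
  by rewrite orderJ.
by rewrite -oG ou.
Qed.

Lemma embeds_not5 G : a6_like G -> ~~ (5 %| #|G|) -> embeds_Alt6 G.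
Proof.
move=> aG n5; have d72 := dvdn72 (a6_card_dvdn aG) n5.
have [P sylP] := Sylow_exists 3 G; have [sPG pP] := (pHall_sub sylP, pHall_pgroup sylP).
have oG := part23_dvd72 d72.
have [P1 | ntP] := eqVneq P 1%G.
  apply: embeds_2group => //; rewrite /pgroup -oG -(card_Hall sylP) P1 cards1 muln1.
  exact: part_pnat.
have iP : #|G : P| = (#|G|`_2)%N by rewrite -divgS // (card_Hall sylP) -{1}oG mulnK
  // part_gt0.
have d8 : #|G : 'N_G(P)| %| 8.
  apply: (@dvdn_trans #|G : P|).
    by apply: indexgS; rewrite subsetI sPG normG.
  by rewrite iP; apply: dvdn_trans (partn_dvd 2 _ d72) _; rewrite ?p_part.
have := card_Syl_mod G (isT : prime 3); rewrite (card_Syl sylP).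
(* Among 1, 2, 4 and 8 only 1 and 4 are 1 modulo 3. *)
move: d8; rewrite dvdn_divisors // !inE => /or4P[]/eqP i //; rewrite i // => _.
- apply: (embeds_sylow3_normal aG sylP ntP) => //.
  rewrite /normal sPG; move/eqP: i; rewrite indexg_eq1 subsetI subxx //.
- exact: (embeds_sylow3_4 aG sylP).
Qed.

End Case3.

(** * Sylow 5-subgroups, their normalisers, and counting *)

Section Case5.

Variable gT : finGroupType.
Implicit Types (G H K P Q T : {group gT}) (x y z : gT) (p q : nat).

Lemma card_setD1g H : #|H^#| = #|H|.-1.
Proof. by rewrite (cardsD1 1 H) group1. Qed.

Lemma a6_sylow5 G y : a6_like G -> y \in G -> #[y] = 5 -> 5.-Sylow(G) <[y]>.
Proof.
move=> aG Gy oy; have y5 : 5.-group <[y]> by rewrite /pgroup -orderE oy.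
have sYG : <[y]> \subset G by rewrite cycle_subG.
have [S sylS sYS] := Sylow_superset sYG y5.
suff -> : <[y]> = S by [].
apply/eqP; rewrite eqEcard sYS -orderE oy dvdn_leq //.
exact: (a6_5group aG (pHall_sub sylS) (pHall_pgroup sylS)).
Qed.

(** As [y] is centralised only by [<[y]>], the index of [<[y]>] in its normaliser is the number of
    conjugates of [y] there, at most 4. The values 3 and 4 are then excluded. *)
Lemma a6_norm5_card G y : a6_like G -> y \in G -> #[y] = 5 ->
  #|'N_G(<[y]>)| = 5 \/ #|'N_G(<[y]>)| = 10.
Proof.
move=> aG Gy oy; have sylY := a6_sylow5 aG Gy oy.
have nty : y != 1 by rewrite -order_eq1 oy.
have cY : 'C_G[y] = <[y]> by apply: (a6_sylow_cent aG sylY); rewrite ?cycle_id.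
set N := 'N_G(<[y]>)%G.
have sYN : <[y]> \subset N by rewrite subsetI (pHall_sub sylY) normG.
have cN : 'C_N[y] = <[y]>.
  apply/eqP; rewrite eqEsubset -{1}cY setSI ?subsetIl //=.
  by rewrite subsetI sYN -{1}cY subsetIr.
have sNG : N \subset G := subsetIl _ _.
have yJ g : g \in N -> exists2 j, y ^ g = y ^+ j & y ^ (g ^+ 4) = y ^+ (j ^ 4).
  move=> /setIP[_ nYg]; have /cycleP[j ej] : y ^ g \in <[y]> by rewrite memJ_norm
    ?cycle_id.
  have eji i : y ^ (g ^+ i) = y ^+ (j ^ i).
    elim: i => [|i IH]; first by rewrite conjg1.
    by rewrite expgSr conjgM IH conjXg ej -expgM expnS.
  by exists j.
(* The fourth power of a unit modulo 5 is 1, so [g ^+ 4] centralises [y]. *)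
have pow4 g : g \in N -> g ^+ 4 \in <[y]>.
  move=> Ng; rewrite -cN; apply/setIP; split; first exact: groupX.
  apply/cent1P; apply/esym/commgP/conjg_fixP.
  have [j ej ->] := yJ g Ng.
  have: y ^+ j != 1 by rewrite -ej conjg_eq1.
  rewrite -(expg_mod_order y j) -(expg_mod_order y (j ^ 4)) -modnXm oy.
  move: (ltn_pmod j (isT : 0 < 5)).
  by case: (j %% 5)%N => [|[|[|[|[|]]]]] //; rewrite eqxx.
have sclass : y ^: N \subset <[y]>^#.
  apply/subsetP=> _ /imsetP[g /setIP[_ nYg] ->].
  by rewrite !inE conjg_eq1 nty memJ_norm ?cycle_id.
have oYd : #|<[y]>^#| = 4 by rewrite card_setD1g -orderE oy.
have le4 := subset_leq_card sclass; rewrite oYd -index_cent1 cN in le4.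
have oN : (5 * #|N : <[y]>|)%N = #|N| by rewrite -(Lagrange sYN) -orderE oy.
have := indexg_gt0 N <[y]>; rewrite -oN.
(* An element of order 3 equals its fourth power, so it would lie in a group of order 5. *)
have no3 : #|N : <[y]>| != 3.
  apply/negP => /eqP i3; have : 3 %| #|N| by rewrite -oN i3.
  case/(Cauchy (isT : prime 3)) => g Ng og.
  have := order_dvdG (pow4 g Ng); rewrite -orderE oy.
  by rewrite (expgD g 3 1) -og expg_order mul1g expg1 og.
(* Here all nontrivial powers of [y] are conjugate; a [g] taking [y] to its square has order 4,
   against [a6_frob20]. *)
have no4 : #|N : <[y]>| != 4.
  apply/negP => /eqP i4.
  have ey : y ^: N = <[y]>^#.
    by apply/eqP; rewrite eqEcard sclass oYd -index_cent1 cN i4.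
  have : y ^+ 2 \in y ^: N by rewrite ey !inE mem_cycle -order_dvdn oy.
  case/imsetP=> g Ng eg; have Gg := subsetP sNG g Ng.
  have nyy : y ^ g != y.
    by rewrite -eg -[X in _ != X]expg1 eq_expg_mod_order oy.
  have nY : g \notin <[y]>.
    by apply: contraNN nyy => /cycleP[i ->]; apply/eqP/conjg_fixP/commgP/commuteX.
  have n2 : g ^+ 2 != 1.
    apply: contraNneq nyy => g2; have : y ^ (g ^+ 2) = y ^+ 4.
      by rewrite conjgM -eg conjXg -eg -expgM.
    by rewrite g2 conjg1 -[LHS]expg1 => /eqP; rewrite eq_expg_mod_order oy.
  have og : #[g] = 4.
    (* If [g] had exponent 3 or 5, then [g ^+ 4] would be [g] or its inverse, and [g] would lie in
       [<[y]>]. *)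
    have := pow4 g Ng; case: (a6_order aG Gg) => [g3|g4|g5].
    - by rewrite (expgD g 3 1) g3 mul1g expg1 (negPf nY).
    - move=> _; have: #[g] %| 4 by rewrite order_dvdn g4.
      by rewrite dvdn_divisors // !inE => /or3P[]/eqP o //; rewrite -order_dvdn o in n2.
    - by rewrite -groupV -(mul1g (g ^+ 4)^-1) -g5 (expgD g 1 4) expg1 mulgK (negPf nY).
  by have := a6_frob20 aG Gy Gg oy og; rewrite eg eqxx.
move: #|_ : _| le4 no3 no4 => [|[|[|[|[|]]]]] //; by [left | right].
Qed.

(** An element of order 5 normalising [P] would force the order of [P] to be 1 modulo 5, but it is 3
    or 9. *)
Lemma a6_norm3_not5 G P : a6_like G -> P \subset G -> 3.-group P -> P :!=: 1 ->
  ~~ (5 %| #|'N_G(P)|).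
Proof.
move=> aG sPG pP ntP; apply/negP => /(Cauchy (isT : prime 5))[y /setIP[Gy nPy] oy].
have := a6_3group aG sPG pP; have := a6_fix5 aG sPG Gy oy nPy.
rewrite (dvdn_divisors #|P|) // !inE => + /or3P[]/eqP oP; rewrite oP => /(_ isT) //.
by rewrite -cardG_gt1 oP in ntP.
Qed.

(** For a nontrivial Sylow subgroup [P] of [K], the Frattini argument leaves an element of order 5
    normalising [P], and none of 2, 4, 8, 3, 9 is 1 modulo 5. *)
Lemma a6_normal_5' G K : a6_like G -> K <| G -> 5 %| #|G| -> ~~ (5 %| #|K|) -> K :=: 1.
Proof.
move=> aG nKG G5 nK5; have sKG := normal_sub nKG; apply/eqP/idPn => ntK.
have := pdiv_prime (_ : 1 < #|K|); rewrite cardG_gt1 ntK => /(_ isT) p_pr.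
set p := pdiv _ in p_pr; have pK : p %| #|K| := pdiv_dvd _.
have [P sylP] := Sylow_exists p K; have [sPK pP] := (pHall_sub sylP, pHall_pgroup sylP).
have sPG := subset_trans sPK sKG.
have ntP : P :!=: 1 by rewrite -cardG_gt1 (card_Hall sylP) p_part_gt1 mem_primes p_pr
  pK cardG_gt0.
have : 5 %| #|'N_G(P)|.
  have : 5 %| #|K| * #|'N_G(P)| by rewrite mul_cardG (Frattini_arg nKG sylP) dvdn_mulr.
  by rewrite Euclid_dvdM // (negPf nK5).
case/(Cauchy (isT : prime 5)) => y /setIP[Gy nPy] oy.
have nP5 : coprime 5 #|P|.
  by rewrite prime_coprime //; apply: contra nK5 => /dvdn_trans; apply; apply: cardSg.
have := a6_fix5 aG sPG Gy oy nPy nP5.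
have := dvdn72 (a6_card_dvdn (a6_likeS aG sKG)) nK5 => d72.
have: p \in primes 72.
  by rewrite mem_primes p_pr (dvdn_trans pK d72).
rewrite (_ : primes 72 = [:: 2; 3]%N) // !inE => /orP[]/eqP ep; rewrite ep in pP.
  have := a6_2group aG sPG pP.
  by rewrite dvdn_divisors // !inE => /or4P[]/eqP oP; rewrite -cardG_gt1 oP in ntP *.
have := a6_3group aG sPG pP.
by rewrite dvdn_divisors // !inE => /or3P[]/eqP oP; rewrite -cardG_gt1 oP in ntP *.
Qed.

Lemma a6_card_support5 G y : a6_like G -> y \in G -> #[y] = 5 ->
  #|class_support <[y]>^# G| = (4 * #|G : 'N_G(<[y]>)|)%N.
Proof.
move=> aG Gy oy; have sylY := a6_sylow5 aG Gy oy.
rewrite (@card_support_normedTI _ _ _ 'N_G(<[y]>)%G).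
  by rewrite card_setD1g -orderE oy.
by apply: (a6_sylow_normedTI aG sylY) => //; rewrite -cardG_gt1 -orderE oy.
Qed.

(** A core with an element of order 5 would contain all Sylow 5-subgroups: their nontrivial
    elements, together with 1, outnumber [H]. So its order is prime to 5, and it is trivial. *)
Lemma a6_core5 G H y : a6_like G -> y \in G -> #[y] = 5 -> 
  #|H| <= 4 * #|G : 'N_G(<[y]>)| -> H \subset G -> gcore H G = 1.
Proof.
move=> aG Gy oy leH sHG; have nK := gcore_normal sHG.
apply: (@a6_normal_5' G (gcore_group H G)) => //.
  by rewrite -oy order_dvdG.
apply/negP=> /(Cauchy (isT : prime 5))[z Kz oz].
have sKH := gcore_sub H G; have Gz := subsetP (normal_sub nK) z Kz.
have sylY := a6_sylow5 aG Gy oy; have sylZ := a6_sylow5 aG Gz oz.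
have : class_support <[y]>^# G \subset (gcore H G)^#.
  have sYK : <[y]> \subset gcore H G.
    have [g Gg /= ->] := Sylow_trans sylZ sylY.
    by rewrite -(normsP (normal_norm nK) g Gg) conjSg cycle_subG.
  apply/subsetP=> _ /imset2P[z0 g /setD1P[ntz0 Yz0] Gg ->].
  by rewrite in_setD1 conjg_eq1 ntz0 memJ_norm ?(subsetP (normal_norm nK)) ?(subsetP
    sYK).
move/subset_leq_card; rewrite a6_card_support5 // => /(leq_trans leH).
have := subset_leq_card sKH; rewrite (cardsD1 1 (gcore H G)) group1 => le1 le2.
by have := leq_trans le1 le2; rewrite add1n ltnn.
Qed.

(** The left side counts the elements of orders 5 and 3, two disjoint sets that omit the
    identity. *)
Lemma a6_count53 G P y : a6_like G -> y \in G -> #[y] = 5 -> 3.-Sylow(G) P ->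
  P :!=: 1 -> 4 * #|G : 'N_G(<[y]>)| + #|P|.-1 * #|G : 'N_G(P)| < #|G|.
Proof.
move=> aG Gy oy sylP ntP; have sylY := a6_sylow5 aG Gy oy.
rewrite -a6_card_support5 // -card_setD1g.
rewrite -(card_support_normedTI (a6_sylow_normedTI aG sylP isT ntP)).
set A := class_support _ _; set B := class_support _ _.
have A5 z : z \in A -> #[z] = 5.
  case/imset2P=> z0 g /setD1P[ntz0 Yz0] _ ->; rewrite orderJ.
  have := order_dvdG Yz0; rewrite -orderE oy (dvdn_divisors #[z0]) // !inE order_eq1.
  by rewrite (negPf ntz0) => /eqP.
have B3 z : z \in B -> #[z] = 3.
  case/imset2P=> z0 g /setD1P[ntz0 Pz0] _ ->; rewrite orderJ.
  apply: (a6_3elt_order aG) => //; first exact: (subsetP (pHall_sub sylP)).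
  exact: mem_p_elt (pHall_pgroup sylP) Pz0.
have sAG : A \subset G by apply: class_support_subG => //;
  rewrite subDset setUC subsetU // (pHall_sub sylY).
have sBG : B \subset G by apply: class_support_subG => //;
  rewrite subDset setUC subsetU // (pHall_sub sylP).
have dAB : A :&: B = set0.
  apply/setP=> z; rewrite !inE; apply/negP => /andP[/A5 + /B3].
  by move=> ->.
rewrite -[X in X < _]subn0 -(cards0 gT) -dAB -cardsU (cardsD1 1 G) group1 ltnS.
apply: subset_leq_card; apply/subsetP=> z /setUP[] Uz; rewrite !inE -order_eq1.
  by rewrite (A5 z) // (subsetP sAG).
by rewrite (B3 z) // (subsetP sBG).
Qed.

End Case5.

(** * Groups of order divisible by 5 *)

Section Case60.

Variable gT : finGroupType.
Implicit Types (G H K P Q T : {group gT}) (x y z : gT) (p q : nat).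

Lemma sylow3_index_cases G P : a6_like G -> 5 %| #|G| -> 3.-Sylow(G) P ->
  P :!=: 1 -> [/\ #|G : 'N_G(P)| %| #|G| %/ #|P|, #|G : 'N_G(P)| %% 3 = 1 &
                  5 %| #|G : 'N_G(P)|]%N.
Proof.
move=> aG G5 sylP ntP; have [sPG pP] := (pHall_sub sylP, pHall_pgroup sylP).
split.
- by rewrite divgS // indexgS // subsetI sPG normG.
- by rewrite -(card_Syl sylP) card_Syl_mod.
have := G5; rewrite -(Lagrange (subsetIl G 'N(P))) Euclid_dvdM //.
by rewrite (negPf (a6_norm3_not5 aG sPG pP ntP)).
Qed.

Lemma card_sylow3 G P : 3.-Sylow(G) P -> #|P| = (3 ^ logn 3 #|G|)%N.
Proof. by move=> sylP; rewrite (card_Hall sylP) p_part. Qed.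

(** [m] is the number of Sylow 3-subgroups. The constraints on it are purely numerical, so
    impossible orders can be excluded by computation. *)
Lemma sylow3_count G y : a6_like G -> y \in G -> #[y] = 5 -> 3 %| #|G| ->
  exists m, [/\ m %| #|G| %/ 3 ^ logn 3 #|G|, m %% 3 = 1, 5 %| m &
    4 * #|G : 'N_G(<[y]>)| + (3 ^ logn 3 #|G|).-1 * m < #|G|]%N.
Proof.
move=> aG Gy oy G3; have [P sylP] := Sylow_exists 3 G.
have G5 : 5 %| #|G| by rewrite -oy order_dvdG.
have ntP : P :!=: 1.
  by rewrite -cardG_gt1 (card_Hall sylP) p_part_gt1 mem_primes G3 cardG_gt0.
exists #|G : 'N_G(P)|; have [] := sylow3_index_cases aG G5 sylP ntP.
by rewrite -(card_sylow3 sylP) => -> -> ->; rewrite a6_count53.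
Qed.

(** The number of Sylow 5-subgroups divides 72 and is 1 modulo 5, hence 1, 6 or 36. With
    self-normalising Sylow 5-subgroups the last two give orders 30 and 180, refuted by counting. *)
Lemma a6_card5_cases G y : a6_like G -> y \in G -> #[y] = 5 ->
  #|G| = 5 \/ #|'N_G(<[y]>)| = 10 /\ #|G : 'N_G(<[y]>)| \in [:: 1; 6; 36]%N.
Proof.
move=> aG Gy oy; have sylY := a6_sylow5 aG Gy oy.
have := card_Syl_mod G (isT : prime 5); rewrite (card_Syl sylY) => n5.
have oG := Lagrange (subsetIl G 'N(<[y]>)).
have d72 : #|G : 'N_G(<[y]>)| %| 72.
  have: 5 * #|G : 'N_G(<[y]>)| %| 5 * 72.
    apply: dvdn_trans (a6_card_dvdn aG); rewrite -oG dvdn_mul //.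
    by case: (a6_norm5_card aG Gy oy) => ->.
  by rewrite dvdn_pmul2l.
have /allP h : all (fun m => (m %% 5 == 1) ==> (m \in [:: 1; 6; 36]))%N (divisors 72).
  by vm_compute.
have := h _ (_ : #|G : 'N_G(<[y]>)| \in divisors 72);
  rewrite -dvdn_divisors // n5 => /(_ d72) /= m3.
case: (a6_norm5_card aG Gy oy) => oN; last by right.
have := sylow3_count aG Gy oy; move: m3 oG; rewrite !inE oN.
case/or3P=> /eqP -> <-; first by left.
  (* Order 30: [m] would be 10, and 24 + 20 exceeds 30. *)
  case/(_ isT) => m []; rewrite (_ : logn 3 _ = 1)%N //.
  have /allP h2 : all (fun m => [&& m %% 3 == 1, 5 %| m & 4 * 6 + 2 * m < 30] ==
    false)%N (divisors 10).
    by vm_compute.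
  by rewrite dvdn_divisors // => /h2/eqP + m3 m5 lt; rewrite m3 m5 lt.
(* Order 180: [m] would be 10, and 144 + 80 exceeds 180. *)
case/(_ isT) => m []; rewrite (_ : logn 3 _ = 2)%N //.
have /allP h2 : all (fun m => [&& m %% 3 == 1, 5 %| m & 4 * 36 + 8 * m < 180] ==
  false)%N (divisors 20).
  by vm_compute.
by rewrite dvdn_divisors // => /h2/eqP + m3 m5 lt; rewrite m3 m5 lt.
Qed.

Lemma a6_card5 G : a6_like G -> 5 %| #|G| -> #|G| \in [:: 5; 10; 60; 360]%N.
Proof.
move=> aG /(Cauchy (isT : prime 5))[y Gy oy].
case: (a6_card5_cases aG Gy oy) => [-> // | [oN]].
rewrite -(Lagrange (subsetIl G 'N(<[y]>))) oN !inE.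
by case/or3P=> /eqP->.
Qed.

Lemma a6_no_index2 G K : a6_like G -> 5 %| #|G| -> #|G| \in [:: 60; 360]%N ->
  K \subset G -> #|G : K| != 2.
Proof.
move=> aG G5 oG sKG; apply/negP => /eqP i2; have oK := Lagrange sKG; rewrite i2 in oK.
have K5 : 5 %| #|K| by move: G5; rewrite -oK Euclid_dvdM // orbF.
have := a6_card5 (a6_likeS aG sKG) K5; move: oG; rewrite -oK !inE.
by case/orP=> /eqP e /or4P[]/eqP oK'; rewrite oK' in e.
Qed.

(** The subgroup is a quotient of the (2,3,5) triangle group. Its generators come from the action on
    the ten Sylow 3-subgroups, where [P] is transitive on the nine others. *)
Lemma ex_sub60 G y : a6_like G -> y \in G -> #[y] = 5 -> #|G| = 360 ->
  exists2 H : {group gT}, H \subset G & #|H| = 60.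
Proof.
move=> aG Gy oy oG.
have [|[oNy _]] := a6_card5_cases aG Gy oy; first by rewrite oG.
have [P sylP] := Sylow_exists 3 G; have [sPG pP] := (pHall_sub sylP, pHall_pgroup sylP).
have oP : #|P| = 9 by rewrite (card_sylow3 sylP) oG.
have ntP : P :!=: 1 by rewrite -cardG_gt1 oP.
have abP := a6_sylow_abelian aG sylP isT.
have G5 : 5 %| #|G| by rewrite oG.
have n3 : #|G : 'N_G(P)| = 10.
  have [dm m3 m5] := sylow3_index_cases aG G5 sylP ntP.
  have := a6_count53 aG Gy oy sylP ntP.
  have -> : #|G : 'N_G(<[y]>)| = 36 by rewrite -divgS ?subsetIl // oG oNy.
  rewrite oP oG in dm *.
  (* The candidates are 10 and 40, and 40 would give 144 + 320 elements of orders 5 and 3. *)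
  have /allP h : all (fun m => [&& m %% 3 == 1, 5 %| m & 4 * 36 + 8 * m < 360] ==> (m
    == 10))%N (divisors 40).
    by vm_compute.
  by move: dm; rewrite dvdn_divisors // => /h/implyP + lt => /(_ _)/eqP -> //;
    rewrite m3 m5 lt.
have oSyl : #|'Syl_3(G)| = 10 by rewrite (card_Syl sylP).
have oN : #|'N_G(P)| = 36.
  by apply/eqP; rewrite -(@eqn_pmul2r 10) // -[X in (_ * X)%N]n3 Lagrange ?subsetIl
    // oG.
have sNG : 'N_G(P) \subset G := subsetIl _ _.
have notN5 z : z \in 'N_G(P) -> #[z] != 5.
  by move=> Nz; apply/eqP => oz; have := order_dvdG Nz; rewrite oz oN.
have [s [Gs os nNs]] : exists s, [/\ s \in G, #[s] = 2 & s \notin 'N_G(P)].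
  have [|s0 Ns0 os0] := @Cauchy _ 2 'N_G(<[y]>)%G isT; first by rewrite /= oNy.
  have [Gs0 nYs0] := setIP Ns0.
  have [Ps0|nPs0] := boolP (s0 \in 'N_G(P)); last by exists s0.
  (* If [s0] and [s0 ^ y] both normalised [P], so would [[~ s0, y]], a nontrivial element of
     [<[y]>], hence of order 5, while 5 does not divide 36. *)
  exists (s0 ^ y); rewrite orderJ groupJ //; split=> //.
  apply/negP => Ps0y.
  have NR : [~ s0, y] \in 'N_G(P) by rewrite commgEl groupM ?groupV.
  have YR : [~ s0, y] \in <[y]>.
    rewrite commgEr groupM ?cycle_id // memJ_norm // groupV cycle_id //.
  have ntR : [~ s0, y] != 1.
    apply/commgP => csy; have [|s1|y1] := a6_commute aG Gs0 Gy csy.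
    - by rewrite os0 oy.
    - by rewrite s1 order1 in os0.
    - by rewrite y1 order1 in oy.
  have := order_dvdG YR; rewrite -orderE oy (dvdn_divisors #[_]) // !inE order_eq1.
  by rewrite (negPf ntR) (negPf (notN5 _ NR)).
have s2 : s * s = 1 by rewrite -expg2 -os expg_order.
have sV : s^-1 = s by apply/eqP; rewrite eq_invg_mul s2.
pose Ps := (P :^ s)%G.
have sylPs : 3.-Sylow(G) Ps by rewrite /= pHallJ.
have Psy : Ps \in 'Syl_3(G) :\ P.
  rewrite !inE sylPs andbT; apply: contra nNs => /eqP/(congr1 val)/= ePs.
  by rewrite inE Gs; apply/normP.
(* A 3-element normalising [Ps] lies in it, and distinct Sylow 3-subgroups meet trivially. *)
have TIPs : 'N_P(Ps) = 1.
  apply/trivgP/subsetP=> x /setIP[Px nx]; rewrite inE; apply: contraTT (Psy) => ntx.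
  rewrite !inE negb_and negbK; apply/orP; left; apply/eqP/val_inj/esym.
  have Gx := subsetP sPG x Px.
  apply: (a6_sylow_TI (x := x) aG sylP sylPs) => //.
  have sylN : 3.-Sylow('N_G(Ps)) Ps.
    by apply: pHall_subl (sylPs); rewrite ?subsetIl // subsetI (pHall_sub sylPs) normG.
  rewrite (mem_normal_Hall sylN) ?normalSG ?(pHall_sub sylPs) //.
    exact: mem_p_elt pP Px.
  by rewrite inE Gx.
have sub_orb H : H \subset 'N_G(P) -> orbit 'JG H Ps \subset 'Syl_3(G) :\ P.
  move=> sHN; apply/subsetP=> _ /imsetP[g Hg ->].
  have [Gg nPg] := setIP (subsetP sHN g Hg).
  rewrite !inE /= pHallJ // sylPs andbT.
  apply/eqP => /(congr1 val) /= e.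
  have : Ps :=: P by apply: (@conjsg_inj _ g); rewrite /= e (normP nPg).
  by move/val_inj => ePs; rewrite ePs !inE eqxx in Psy.
have oSyl1 : #|'Syl_3(G) :\ P| = 9.
  by have := cardsD1 P 'Syl_3(G); rewrite oSyl inE sylP => -[].
(* [P] moves [Ps] with trivial stabiliser, so the 9 images are all the other Sylow 3-subgroups. *)
have orbP : orbit 'JG P Ps = 'Syl_3(G) :\ P.
  apply/eqP; rewrite eqEcard sub_orb ?subsetI ?sPG ?normG //= oSyl1.
  by rewrite card_orbit astab1JG TIPs indexg1 oP.
(* C <*> <[s]> is the stabiliser of the pair {P, P^s}: a dihedral group of
   order 8 whose elements outside the cyclic group C are all involutions. *)
pose C := 'N_('N_G(P))(Ps)%G.
have sCN : C \subset 'N_G(P) := subsetIl _ _.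
have sCG := subset_trans sCN sNG.
(* The normaliser of [P], of order 36, has the same orbit of length 9. *)
have oC : #|C| = 4.
  have : #|'N_G(P) : C| = 9.
    have -> : #|'N_G(P) : C| = #|orbit 'JG 'N_G(P) Ps| by rewrite card_orbit astab1JG.
    apply/eqP; rewrite eqn_leq -{1}oSyl1 subset_leq_card ?sub_orb //=.
    by rewrite -oSyl1 -orbP; apply: subset_leq_card; apply: imsetS;
      rewrite subsetI sPG normG.
  by move=> i9; apply/eqP; rewrite -(@eqn_pmul2r 9) // -[X in (_ * X)%N]i9 Lagrange
    // oN.
have pC : 2.-group C by rewrite /pgroup oC.
have eqN : P * C = 'N_G(P).
  apply/eqP; rewrite eqEcard mulG_subG subsetI sPG normG sCN /=.
  by rewrite coprime_cardMg ?oP ?oC // oN.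
(* [s] interchanges [P] and [Ps], hence normalises the stabiliser of both. *)
have nCs : s \in 'N(C).
  rewrite inE; apply/subsetP=> _ /imsetP[c /setIP[/setIP[Gc nPc] nPsc] ->].
  have normJs A B : c \in 'N(A) -> A :^ s = B -> c ^ s \in 'N(B).
    by move=> nAc <-; rewrite normJ memJ_conjg.
  apply/setIP; split; last exact: normJs nPc _.
  by rewrite inE groupJ //=; apply: normJs nPsc _; rewrite /= -conjsgM s2 conjsg1.
have nCsC : s \notin C by apply: contra nNs; apply: (subsetP sCN).
have pT : 2.-group (C <*> <[s]>).
  rewrite norm_joinEr ?cycle_subG // /pgroup.
  apply: (@pnat_dvd _ (#|C| * #|<[s]>|)); first by rewrite mul_cardG dvdn_mulr.
  by rewrite oC -orderE os.
have sTG : C <*> <[s]> \subset G by rewrite join_subG sCG cycle_subG.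
have /cyclicP[u eC] : cyclic C.
  apply: (a6_norm3_cyclic aG sPG pP abP ntP sCG pC).
  exact: subset_trans sCN (subsetIr _ _).
have ou : #[u] = 4 by rewrite orderE -eC.
have Tu : u \in C <*> <[s]> by rewrite mem_gen // inE eC cycle_id.
have Ts : s \in C <*> <[s]> by rewrite mem_gen // inE cycle_id orbT.
(* As G = N U N s P, the element y is conjugate to some n * s with n = x * c in
   N = P C, and c * s is an involution. *)
have nNy : y \notin 'N_G(P) by apply: contraL (introT eqP oy) => /notN5.
have : (P :^ y)%G \in orbit 'JG P Ps.
  rewrite orbP !inE /= pHallJ // sylP andbT; apply: contra nNy => /eqP/(congr1 val)/= e.
  by rewrite inE Gy; apply/normP.
case/imsetP=> z Pz /(congr1 val) /= ePy; have Gz := subsetP sPG z Pz.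
have Nn : y * z^-1 * s \in 'N_G(P).
  apply/setIP; split; first by rewrite !groupM ?groupV.
  by apply/normP; rewrite !conjsgM ePy conjsgK -{2}sV conjsgK.
have : z * (y * z^-1 * s) \in 'N_G(P).
  by rewrite groupM // inE Gz (subsetP (normG P)).
rewrite -eqN => /mulsgP[x c Px Cc exc].
have oxcs : #[x * (c * s)] = 5.
  have -> : x * (c * s) = y ^ z^-1.
    by rewrite mulgA -exc /conjg invgK !mulgA -!(mulgA _ s) s2 mulg1.
  by rewrite orderJ.
have Tc : c \in C <*> <[s]> by rewrite mem_gen // inE Cc.
have [|ocs _] := a6_notin_cycle4 aG sTG pT Tu (groupM Tc Ts) ou.
  by rewrite -eC groupMl.
have ntx : x != 1.
  by apply/eqP => x1; move: oxcs; rewrite x1 mul1g ocs.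
have Gx := subsetP sPG x Px; have Gcs : c * s \in G by rewrite groupM // (subsetP sCG).
have ox := a6_3elt_order aG Gx (mem_p_elt pP Px) ntx.
have sHG : <<[set x; c * s]>> \subset G by rewrite gen_subG;
  apply/subsetP=> w /set2P[]->.
exists [group of <<[set x; c * s]>>] => //.
have le60 : #|<<[set x; c * s]>>| <= 60.
  by apply: card_gen_235; [rewrite -ocs | rewrite -ox | rewrite -oxcs];
    rewrite expg_order.
have Hx : x \in <<[set x; c * s]>> by rewrite mem_gen ?set21.
have Hcs : c * s \in <<[set x; c * s]>> by rewrite mem_gen ?set22.
have H3 : 3 %| #|<<[set x; c * s]>>| by rewrite -ox order_dvdG.
have H5 : 5 %| #|<<[set x; c * s]>>| by rewrite -oxcs order_dvdG // groupM.
(* Of the orders 5, 10, 60 and 360, only 60 is divisible by 3 and at most 60. *)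
have := a6_card5 (a6_likeS aG sHG) H5; rewrite !inE.
by case/or4P=> /eqP // oH; rewrite oH in H3 le60.
Qed.

Lemma embeds_5 G : a6_like G -> 5 %| #|G| -> embeds_Alt6 G.
Proof.
move=> aG G5; have [y Gy oy] := Cauchy (isT : prime 5) G5.
have oG := Lagrange (subsetIl G 'N(<[y]>)).
have [oG5 | [oN]] := a6_card5_cases aG Gy oy; first exact: (embeds_C5 Gy oy oG5).
rewrite oN in oG; rewrite !inE => /or3P[]/eqP i; rewrite i in oG.
- have [|t /setIP[Gt nYt] ot] := @Cauchy _ 2 'N_G(<[y]>)%G isT; first by rewrite /= oN.
  apply: (embeds_D10 Gy Gt oy ot) => //.
  have [k k5 eyt] : exists2 k, k < 5 & y ^ t = y ^+ k.
    have /cycleP[k ->] : y ^ t \in <[y]> by rewrite memJ_norm ?cycle_id.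
    by exists (k %% 5)%N; rewrite ?ltn_pmod // -oy expg_mod_order.
  have nyy : y ^ t != y.
    apply/eqP => /conjg_fixP/commgP cyt; have [|y1|t1] := a6_commute aG Gy Gt cyt.
    - by rewrite oy ot.
    - by rewrite y1 order1 in oy.
    - by rewrite t1 order1 in ot.
  (* Since [t] is an involution, [k] is a square root of 1 modulo 5, hence 1 or 4, and [nyy]
     excludes 1. *)
  have /eqP: y ^+ (k * k) = y ^+ 1.
    by rewrite expgM -eyt -conjXg -eyt -conjgM -expg2 -ot expg_order conjg1.
  rewrite eq_expg_mod_order oy; case: k k5 eyt => [|[|[|[|[|]]]]] // _ eyt _.
    by rewrite eyt expg1 eqxx in nyy.
  by apply/eqP; rewrite eyt eq_sym eq_invg_mul -expgS -order_dvdn oy.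
- apply: (@embeds_index6 _ G 'N_G(<[y]>)%G); rewrite ?subsetIl //.
    by apply: (a6_core5 aG Gy oy); rewrite ?subsetIl // i /= oN.
  by move=> K; apply: a6_no_index2; rewrite // -oG.
have [H sHG oH] := ex_sub60 aG Gy oy (esym oG).
apply: (@embeds_index6 _ G H) => //.
(* The core criterion asks that 60 be at most 4 times 36. *)
- by apply: (a6_core5 aG Gy oy) => //; rewrite i oH.
- by rewrite -divgS // -oG oH.
by move=> K; apply: a6_no_index2; rewrite // -oG.
Qed.

Theorem a6_like_embeds G : a6_like G -> embeds_Alt6 G.
Proof.
by move=> aG; have [/(embeds_5 aG) | /(embeds_not5 aG)] := boolP (5 %| #|G|).
Qed.

End Case60.
(** * The identities hold in the alternating group *)

(* Elements of the group have order at most 5, so x^12 = 1 iff x^3 = 1 or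
   x^4 = 1, and similarly for the exponents 15, 20 and 30. *)
Definition texp2 t := tmul t t == tone.
Definition texp3 t := tmul t (tmul t t) == tone.
Definition texp4 t := let u := tmul t t in tmul u u == tone.
Definition texp5 t := let u := tmul t t in tmul t (tmul u u) == tone.
Definition texp12 t := texp3 t || texp4 t.
Definition texp15 t := texp3 t || texp5 t.
Definition texp20 t := texp4 t || texp5 t.
Definition texp30 t := [|| texp2 t, texp3 t | texp5 t].

Definition check2 (L0 : seq (seq nat)) : bool := all (fun t => [|| texp3 t, texp4 t |
  texp5 t]) L0.

(* Linked elements of order 3 generate a 3-group, hence commute. *)
Definition link3 a b :=
  [&& a != b, ~~ texp20 (tmul a b) & ~~ texp20 (tmul a (tmul b b))].
(** A counterexample to (3) links its first element to the eight others, so the bound 7 refutes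
    it. *)
Definition check3 (L0 : seq (seq nat)) : bool :=
  let L := [seq t <- L0 | ~~ texp20 t] in
  all (fun a => size [seq b <- L | link3 a b] <= 7) L.

Definition check4 (L0 : seq (seq nat)) : bool :=
  let L := [seq t <- L0 | ~~ texp30 t] in
  all (fun a => all (fun b =>
    [|| texp15 (tmul a b), texp15 (tmul a (tmul b b))
      | texp15 (tmul a (tmul b (tmul b b)))]) L) L.

Definition tcyc u v : bool :=
  let vv := tmul v v in [|| u == tone, u == v, u == vv | u == tmul v vv].
Definition unlink5 a b :=
  let bb := tmul b b in
  [|| tcyc a b, texp15 (tmul a b), texp15 (tmul a bb) | texp15 (tmul a (tmul b bb))].
Definition ttheta a b c :=
  let bc := tmul b c in tcyc a bc || tcyc (tmul a b) bc.
(** Only elements not ruled out against [a] enter [N], which keeps the number of triples small. *)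
Definition check5 (L0 : seq (seq nat)) : bool :=
  let L := [seq t <- L0 | ~~ texp15 t] in
  all (fun a =>
    let N := [seq b <- L | ~~ (unlink5 a b || unlink5 b a)] in
    all (fun b => all (fun c => [|| unlink5 b c, unlink5 c b,
       ttheta a b c, ttheta a c b, ttheta b a c, ttheta b c a,
       ttheta c a b | ttheta c b a]) N) N) L.

(** Elements of [L4] have order 4, so the cube [bi] is the inverse of [b]; the cube of the conjugate
    [ab] stands for the conjugate of the cube of [a]. *)
Definition check6 (L0 : seq (seq nat)) : bool :=
  let L5 := [seq t <- L0 | ~~ texp12 t] in
  let L4 := [seq t <- L0 | ~~ texp30 t] in
  all (fun b => let bi := tmul b (tmul b b) in
    all (fun a => let ab := tmul bi (tmul a b) in
      [|| texp12 (tmul a ab), texp12 (tmul (tmul a a) ab)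
        | texp12 (tmul a (tmul ab (tmul ab ab)))]) L5) L4.

Definition check7 (L0 : seq (seq nat)) : bool :=
  let L := [seq t <- L0 | ~~ texp12 t] in
  all (fun a => all (fun b =>
    let ab := tmul a b in
    texp12 ab || (let ab2 := tmul ab b in
    texp12 ab2 || (let ab3 := tmul ab2 b in
    texp12 ab3 || texp12 (tmul ab3 b)))) L) L.

Lemma check2_true : check2 talt. Proof. by vm_compute. Qed.
Lemma check3_true : check3 talt. Proof. by vm_compute. Qed.
Lemma check4_true : check4 talt. Proof. by vm_compute. Qed.
Lemma check5_true : check5 talt. Proof. by vm_compute. Qed.
Lemma check6_true : check6 talt. Proof. by vm_compute. Qed.
Lemma check7_true : check7 talt. Proof. by vm_compute. Qed.

Local Notation aT := (subg_of 'Alt_('I_6)%G).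

Definition stab (x : aT) : seq nat := tab (sgval x).

Lemma stab_inj : injective stab.
Proof. by move=> x y /tab_inj/val_inj. Qed.

Lemma stab1 : stab 1 = tone.
Proof. exact: tab1. Qed.

Lemma stabM x y : stab (x * y) = tmul (stab x) (stab y).
Proof. exact: tabM. Qed.

(* Hides [talt] behind a variable: unification would otherwise evaluate it. *)
Lemma stab_list (P : seq (seq nat) -> bool) : P talt ->
  exists2 L, forall x, stab x \in L & P L.
Proof. by exists talt => // x; apply/tab_Alt/subgP. Qed.

Lemma eq_stab1 x : (stab x == tone) = (x == 1).
Proof. by rewrite -stab1 (inj_eq stab_inj). Qed.

Lemma texp2E x : texp2 (stab x) = (x ^+ 2 == 1).
Proof. by rewrite /texp2 -!stabM eq_stab1. Qed.

Lemma texp3E x : texp3 (stab x) = (x ^+ 3 == 1).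
Proof. by rewrite /texp3 -!stabM eq_stab1. Qed.

Lemma texp4E x : texp4 (stab x) = (x ^+ 4 == 1).
Proof. by rewrite /texp4 -!stabM eq_stab1 !expgS expg0 mulg1 !mulgA. Qed.

Lemma texp5E x : texp5 (stab x) = (x ^+ 5 == 1).
Proof. by rewrite /texp5 -!stabM eq_stab1 !expgS expg0 mulg1 !mulgA. Qed.

Lemma gpowE (gT : finGroupType) (x : group_of_fin gT) n :
  gpow x n = ((x : gT) ^+ n : gT).
Proof. by elim: n => //= n IH; rewrite expgS -IH. Qed.

Lemma expg_multiple (gT : finGroupType) (x : gT) m n :
  x ^+ m == 1 -> m %| n -> x ^+ n = 1.
Proof. by move=> /eqP xm /dvdnP[k ->]; rewrite mulnC expgM xm expg1n. Qed.

Lemma texp12_1 x : texp12 (stab x) -> gpow (x : A6) 12 = gone A6.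
Proof.
by rewrite gpowE /texp12 texp3E texp4E => /orP[] /expg_multiple; apply.
Qed.

Lemma texp15_1 x : texp15 (stab x) -> gpow (x : A6) 15 = gone A6.
Proof.
by rewrite gpowE /texp15 texp3E texp5E => /orP[] /expg_multiple; apply.
Qed.

Lemma texp20_1 x : texp20 (stab x) -> gpow (x : A6) 20 = gone A6.
Proof.
by rewrite gpowE /texp20 texp4E texp5E => /orP[] /expg_multiple; apply.
Qed.

Lemma texp30_1 x : texp30 (stab x) -> gpow (x : A6) 30 = gone A6.
Proof.
by rewrite gpowE /texp30 texp2E texp3E texp5E => /or3P[] /expg_multiple; apply.
Qed.

Lemma A6_did1 : did1 A6.
Proof.
move=> x; have /injectivePn[i [j nij eij]] : ~~ injectiveb (x : 'I_361 -> aT).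
  apply/negP => /injectiveP/card_codom; rewrite card_ord => c.
  have := max_card (mem (codom (x : 'I_361 -> aT))); rewrite c.
  have -> : #|{: aT}| = #|'Alt_('I_6)|.
    by rewrite (card_isog (isog_subg 'Alt_('I_6)%G)) cardsT.
  by rewrite leqNgt -(@ltn_pmul2l 2) // card_Alt ?card_ord.
case: (ltngtP i j) => [lt | lt | /val_inj e]; last by rewrite e eqxx in nij.
  by exists i, j.
by exists j, i.
Qed.

Lemma A6_did2 : did2 A6.
Proof.
have [L0 mem_L0 h] := stab_list check2_true.
move=> x; have := allP h _ (mem_L0 x); rewrite texp3E texp4E texp5E !gpowE.
by case/or3P=> /eqP; [left | right; left | right; right].
Qed.

Lemma A6_did3 : did3 A6.
Proof.
have [L0 mem_L0 h] := stab_list check3_true.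
move=> x; case: (pickP (fun i => texp20 (stab (x i)))) => [i /texp20_1|n20];
  first by left; exists i.
right; pose P i j := [|| x i == x j :> aT, texp20 (stab (x i * x j : aT)) |
   texp20 (stab (x i * (x j * x j) : aT))].
case: (pickP (fun j : 'I_9 => (0 < j) && P ord0 j)) => [j /andP[j0]|nP].
  case/or3P=> [/eqP e | /texp20_1 e | /texp20_1 e].
  - by left; exists ord0, j; split; [exact: j0 | exact: e].
  - by right; left; exists ord0, j; split; [exact: j0 | exact: e].
  - by right; right; exists ord0, j; split; [exact: j0 | rewrite [gpow (x j) 2]gpowE;
    exact: e].
case: (pickP (fun p : 'I_9 * 'I_9 => (p.1 < p.2) && (x p.1 == x p.2 :> aT))) => [[i
  j] /andP[lt /eqP e]|inj].
  by left; exists i, j; split; [exact: lt | exact: e].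
have Lx i : stab (x i) \in [seq t <- L0 | ~~ texp20 t].
  by rewrite mem_filter mem_L0 n20.
have := allP h _ (Lx ord0); set N := filter _ _.
(* The other eight values are distinct and all linked to the first, one more than [check3]
   allows. *)
suff : 8 <= size N by case: ltngtP.
have -> : 8 = size [seq stab (x (lift ord0 i)) | i <- enum 'I_8] by rewrite size_map
  size_enum_ord.
apply: uniq_leq_size.
  suff inj' : injective (fun i : 'I_8 => stab (x (lift ord0 i))).
    by rewrite (map_inj_uniq inj') enum_uniq.
  have lt_ne (k l : 'I_8) : x (lift ord0 k) = x (lift ord0 l) :> aT -> (k < l) = false.
    by move=> ekl; have := inj (lift ord0 k, lift ord0 l);
      rewrite /= ekl eqxx andbT ltnS.
  move=> i j /stab_inj e; apply: val_inj; apply/eqP.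
  by have := lt_ne i j e; have := lt_ne j i (esym e); case: ltngtP.
move=> _ /mapP[i _ ->]; rewrite mem_filter Lx andbT /link3 -!stabM (inj_eq stab_inj).
by have := nP (lift ord0 i); rewrite /= /P => /negbT; rewrite !negb_or.
Qed.

Lemma A6_did4 : did4 A6.
Proof.
have [L0 mem_L0 h] := stab_list check4_true.
move=> x y; have [/texp30_1|nx] := boolP (texp30 (stab x)); first by left.
have [/texp30_1|ny] := boolP (texp30 (stab y)); first by right; left.
have L (z : aT) : ~~ texp30 (stab z) -> stab z \in [seq t <- L0 | ~~ texp30 t].
  by move=> nz; rewrite mem_filter nz mem_L0.
have := allP (allP h _ (L x nx)) _ (L y ny); rewrite -!stabM.
have -> : gpow y 2 = y * y :> aT by rewrite gpowE.
have -> : gpow y 3 = y * (y * y) :> aT by rewrite gpowE.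
by case/or3P=> /texp15_1 e; right; right; [left | right; left | right; right].
Qed.

Lemma tcycP (u v : A6) : tcyc (stab u) (stab v) -> in_cyc u v.
Proof.
rewrite /tcyc -!stabM eq_stab1 !(inj_eq stab_inj) /in_cyc !gpowE.
by case/or4P=> /eqP; [left | right; left | right; right; left | right; right; right].
Qed.

Lemma A6_did5 : did5 A6.
Proof.
have [L0 mem_L0 h] := stab_list check5_true.
move=> x; pose o0 : 'I_3 := ord0; pose o1 : 'I_3 := Ordinal (isT : 1 < 3);
  pose o2 : 'I_3 := ord_max.
have [n01 n02 n12] : [/\ o0 <> o1, o0 <> o2 & o1 <> o2].
  by split=> /(congr1 val).
case: (pickP (fun i => texp15 (stab (x i)))) => [i /texp15_1|n15].
  by right; left; exists i.
have L i : stab (x i) \in [seq t <- L0 | ~~ texp15 t] by rewrite mem_filter mem_L0 n15.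
have unlinkP i j : i <> j -> unlink5 (stab (x i)) (stab (x j)) ->
    theta x \/ (exists i, gpow (x i) 15 = gone A6) \/
    (exists i j : 'I_3, i <> j /\ gpow (gmul (x i) (x j)) 15 = gone A6) \/
    (exists i j : 'I_3, i <> j /\ gpow (gmul (x i) (gpow (x j) 2)) 15 = gone A6) \/
    (exists i j : 'I_3, i <> j /\ gpow (gmul (x i) (gpow (x j) 3)) 15 = gone A6).
  move=> nij; rewrite /unlink5 -!stabM => /or4P[/tcycP e | /texp15_1 e | /texp15_1 e
    | /texp15_1 e].
  - by left; left; exists i, j; split; [exact: nij | exact: e].
  - by right; right; left; exists i, j; split; [exact: nij | exact: e].
  - right; right; right; left; exists i, j; split; first exact: nij.
    by rewrite [gpow (x j) 2]gpowE; exact: e.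
  - right; right; right; right; exists i, j; split; first exact: nij.
    by rewrite [gpow (x j) 3]gpowE; exact: e.
have thetaP i j k : i <> j -> j <> k -> i <> k ->
    ttheta (stab (x i)) (stab (x j)) (stab (x k)) -> theta x.
  move=> nij njk nik; rewrite /ttheta -!stabM => /orP[]/tcycP e.
    by right; left; exists i, j, k; split; [split | exact: e].
  by right; right; exists i, j, k; split; [split | exact: e].
have [/orP[]|ul01] := boolP (unlink5 (stab (x o0)) (stab (x o1)) || unlink5 (stab (x
  o1)) (stab (x o0))).
- by apply: unlinkP.
- by apply: unlinkP => /esym.
have [/orP[]|ul02] := boolP (unlink5 (stab (x o0)) (stab (x o2)) || unlink5 (stab (x
  o2)) (stab (x o0))).
- by apply: unlinkP.
- by apply: unlinkP => /esym.
have N1 : stab (x o1) \in [seq b <- [seq t <- L0 | ~~ texp15 t] |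
    ~~ (unlink5 (stab (x o0)) b || unlink5 b (stab (x o0)))] by rewrite mem_filter
      ul01 L.
have N2 : stab (x o2) \in [seq b <- [seq t <- L0 | ~~ texp15 t] |
    ~~ (unlink5 (stab (x o0)) b || unlink5 b (stab (x o0)))] by rewrite mem_filter
      ul02 L.
have := allP (allP (allP h _ (L o0)) _ N1) _ N2.
have [n10 n20 n21] := And3 (nesym n01) (nesym n02) (nesym n12).
case/or4P=> [||th|/or4P[th|th|th|/orP[th|th]]].
- exact: unlinkP.
- exact: unlinkP.
- by left; apply: thetaP th.
- by left; apply: thetaP th.
- by left; apply: thetaP th.
- by left; apply: thetaP th.
- by left; apply: thetaP th.
- by left; apply: thetaP th.
Qed.

Lemma invg_cube (gT : finGroupType) (x : gT) : x ^+ 4 = 1 -> x^-1 = x * (x * x).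
Proof. by move=> x4; apply/eqP; rewrite eq_invg_mul; apply/eqP. Qed.

Lemma A6_did6 : did6 A6.
Proof.
have [L0 mem_L0 h] := stab_list check6_true.
move=> x y; have [/texp12_1|nx] := boolP (texp12 (stab x)); first by left.
have [/texp30_1|ny] := boolP (texp30 (stab y)); first by right; left.
have Lx : stab x \in [seq t <- L0 | ~~ texp12 t] by rewrite mem_filter nx mem_L0.
have Ly : stab y \in [seq t <- L0 | ~~ texp30 t] by rewrite mem_filter ny mem_L0.
have y4 : (y : aT) ^+ 4 = 1.
  move: ny; rewrite /texp30 !negb_or texp3E texp5E => /and3P[_ n3 n5].
  case: (A6_did2 y) => [|[|]]; rewrite gpowE => e //.
    by rewrite e eqxx in n3.
  by rewrite e eqxx in n5.
have yV := invg_cube y4.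
have := allP (allP h _ Ly) _ Lx; lazy beta zeta; rewrite -!stabM -yV.
have -> : ginv y = (y : aT)^-1 by [].
have -> : gpow x 2 = x * x :> aT by rewrite gpowE.
have -> : gmul ((y : aT)^-1 : A6) (gmul (gpow x 3) y) =
    (y^-1 * (x * y)) * ((y^-1 * (x * y)) * (y^-1 * (x * y))) :> aT.
  by rewrite gpowE -[LHS]/((x ^+ 3) ^ y) conjXg.
by case/or3P=> /texp12_1 e; right; right; [left | right; right | right; left].
Qed.

Lemma A6_did7 : did7 A6.
Proof.
have [L0 mem_L0 h] := stab_list check7_true.
move=> x y; have [/texp12_1|nx] := boolP (texp12 (stab x)); first by left.
have [/texp12_1|ny] := boolP (texp12 (stab y)); first by right; left.
have L (z : aT) : ~~ texp12 (stab z) -> stab z \in [seq t <- L0 | ~~ texp12 t].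
  by move=> nz; rewrite mem_filter nz mem_L0.
have := allP (allP h _ (L x nx)) _ (L y ny); lazy beta zeta; rewrite -!stabM.
case/or4P=> /texp12_1 e; right; right; [exists 1%N | exists 2 | exists 3 | exists 4];
  split=> //; rewrite [gpow y _]gpowE.
- exact: e.
- by rewrite -mulgA in e; exact: e.
- by rewrite -!mulgA in e; exact: e.
- by rewrite -!mulgA in e; exact: e.
Qed.

Theorem A6_all_dids : all_dids A6.
Proof.
by do 6?split; [apply: A6_did1 | apply: A6_did2 | apply: A6_did3 | apply: A6_did4
  | apply: A6_did5 | apply: A6_did6 | apply: A6_did7].
Qed.
(** * From the identities to the local structure *)

Section FromIdentities.

Variable gT : finGroupType.
Local Notation gG := (group_of_fin gT).
Implicit Types (P T : {group gT}) (x y z : gT).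

Lemma did2_order (d2 : did2 gG) x : [\/ x ^+ 3 = 1, x ^+ 4 = 1 | x ^+ 5 = 1].
Proof. by case: (d2 x) => [|[]]; rewrite gpowE => e;
  [apply: Or31 | apply: Or32 | apply: Or33]. Qed.

(** One of the exponents 3, 4, 5 kills [x]; if it is not [n] it is prime to [p], and then [x] is
    trivial. *)
Lemma did2_pexp (d2 : did2 gG) p n x :
  all (fun m => (m == n) || p^'.-nat m) [:: 3; 4; 5]%N -> p.-elt x -> x ^+ n = 1.
Proof.
move=> /allP pn px; have [m m345 xm] : exists2 m, m \in [:: 3; 4; 5]%N & x ^+ m == 1.
  by case: (did2_order d2 x) => /eqP e; [exists 3 | exists 4 | exists 5].
have /orP[/eqP <- | p'm] := pn m m345; first exact/eqP.
suff /eqP : #[x] == 1%N by move/eqP; rewrite order_eq1 => /eqP ->; rewrite expg1n.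
rewrite -order_dvdn in xm.
by apply/eqP/(pnat_1 px); apply: pnat_dvd p'm.
Qed.

(** In a 3-group of exponent 3 and order at least 27, nine nontrivial elements can be chosen, no two
    equal or mutually inverse; they violate (3), since a trivial 20th power means a trivial
    element. *)
Lemma did3_3group (d2 : did2 gG) (d3 : did3 gG) P : 3.-group P -> #|P| %| 9.
Proof.
move=> pP.
have cube x : x \in P -> x ^+ 3 = 1.
  by move=> Px; apply: (did2_pexp (p := 3) d2) (mem_p_elt pP Px).
apply/idPn => n9; have le27 : 27 <= #|P|.
  move: n9; rewrite (card_pgroup pP) -[9]/(3 ^ 2)%N dvdn_Pexp2l // -ltnNge => n9.
  by rewrite (@leq_pexp2l 3 3).
have [s [ss us sP]] : exists s : seq gT, [/\ size s = 9, uniq s &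
    {subset s <= P^#} /\ {in s &, forall x y, x * y != 1}].
  (* Greedy choice: with [k] elements chosen, at most 1 + 2k values are forbidden, fewer than 27
     since [k] is below 9. *)
  have: 9 <= 9 by []; elim: {1 3}9 => [|k IH] lek; first by exists [::].
  have [s [ss us [sP ns]]] := IH (ltnW lek).
  have [x Px nx] : exists2 x, x \in P & x \notin 1 :: s ++ [seq y^-1 | y <- s].
    apply/subsetPn; apply/negP => /subset_leq_card.
    move/(leq_trans le27)/leq_trans/(_ (card_size _)).
    by rewrite /= size_cat size_map ss; lia.
  move: nx; rewrite inE mem_cat !negb_or => /and3P[x1 nsx nsVx].
  have xx : x * x != 1.
    by apply: contraNneq x1 => e; rewrite -[x]mulg1 -{1}e; apply/eqP; apply: cube.
  exists (x :: s); split; rewrite /= ?ss ?nsx //; split.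
    by move=> y; rewrite inE => /orP[/eqP-> | /sP //]; rewrite !inE x1.
  have xs y : y \in s -> x * y != 1.
    move=> sy; apply: contraNneq nsVx => xy; apply/mapP; exists y => //.
    by apply/eqP; rewrite eq_sym eq_invg_mul -(inj_eq (mulgI x)) mulgA xy mul1g mulg1.
  move=> y z; rewrite !inE => /orP[/eqP-> | sy] /orP[/eqP-> | sz] //; try exact: xs;
    last exact: ns.
  by apply: contraNneq (xs y sy) => yx; rewrite -(inj_eq (mulgI y)) mulgA yx mul1g
    mulg1.
case: sP => sP ns.
pose x (i : 'I_9) : gT := nth 1 s i.
have sx i : x i \in s by rewrite mem_nth // ss.
have Px i : x i \in P by have := sP _ (sx i); rewrite !inE => /andP[].
have x1 i : x i != 1 by have := sP _ (sx i); rewrite !inE => /andP[].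
have pow20 y : y \in P -> y ^+ 20 = 1 -> y = 1.
  move=> Py; rewrite (expgD y 18 2) (expgM y 3 6) cube // expg1n mul1g => y2.
  by rewrite -(cube y Py) expgS y2 mulg1.
case: (d3 x) => [[i]|[[i [j [lt e]]]|[[i [j [lt]]]|[i [j [lt]]]]]]; rewrite ?gpowE.
- by move/(pow20 _ (Px i))/eqP; rewrite (negPf (x1 i)).
- by move/eqP: e; rewrite nth_uniq ?ss // => /eqP e; rewrite e ltnn in lt.
- move/(pow20 _ (groupM (Px i) (Px j)))/eqP.
  by rewrite (negPf (ns _ _ (sx i) (sx j))).
(* As [x j] has exponent 3, its square is its inverse. *)
move/(pow20 _ (groupM (Px i) (groupX 2 (Px j)))) => e.
have : x i = x j.
  by rewrite -[LHS]mulg1 -(cube _ (Px j)) expgSr mulgA e mul1g.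
by move/eqP; rewrite nth_uniq ?ss // => /eqP e'; rewrite e' ltnn in lt.
Qed.

(** A 15th power in [T] is an inverse, because [T] has exponent 4. So (4), applied to [y] and [x],
    yields [y * x ^+ n = 1] for some [n] among 1, 2, 3. *)
Lemma did4_cycle4 (d2 : did2 gG) (d4 : did4 gG) T x y : 2.-group T ->
  x \in T -> y \in T -> #[x] = 4 -> #[y] = 4 -> y \in <[x]>.
Proof.
move=> pT Tx Ty ox oy.
have pow z n : #[z] = 4 -> gpow (z : gG) n = gone gG -> 4 %| n.
  by move=> oz; rewrite gpowE => e; rewrite -oz order_dvdn; apply/eqP.
have pow15 z : z \in T -> gpow (z : gG) 15 = gone gG -> z = 1.
  move=> Tz; rewrite gpowE => e.
  have z4 : z ^+ 4 = 1 by apply: (did2_pexp (p := 2) d2) (mem_p_elt pT Tz).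
  have : z ^+ 16 = 1 by rewrite (expgM z 4 4) z4 expg1n.
  by rewrite expgS e mulg1.
have inx n : y * x ^+ n = 1 -> y \in <[x]>.
  by move=> e; rewrite -(groupMr _ (mem_cycle x n)) e group1.
case: (d4 y x) => [/(pow _ _ oy) // | [/(pow _ _ ox) // | [/pow15|[/pow15|/pow15]]]].
- move=> /(_ (groupM Ty Tx)) e; apply: (inx 1%N); by rewrite expg1.
- by rewrite gpowE => /(_ (groupM Ty (groupX 2 Tx))); apply: inx.
by rewrite gpowE => /(_ (groupM Ty (groupX 3 Tx))); apply: inx.
Qed.

(** If the order exceeds 4, independent [a], [b], [c] violate (5): each element equals its 15th
    power, [<[v]>] is {1, v}, and every alternative becomes a linear relation among the three. *)
Lemma did5_2abelem (d5 : did5 gG) T : 2.-abelem T -> #|T| %| 4.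
Proof.
case/and3P=> pT abT exT.
have sq x : x \in T -> x * x = 1 by move=> Tx; apply: (exponentP exT).
apply/idPn => n4; have gt4 : 4 < #|T|.
  move: n4; rewrite (card_pgroup pT) -[X in _ %| X]/(2 ^ 2)%N dvdn_Pexp2l // -ltnNge
    => n4.
  by rewrite -[X in X < _]/(2 ^ 2)%N ltn_exp2l.
have cT x y : x \in T -> y \in T -> x * y = y * x by move=> Tx; apply: (centsP abT).
have [a Ta na] : exists2 a, a \in T & a \notin [set 1].
  by apply/subsetPn/negP => /subset_leq_card; rewrite cards1 leqNgt (leq_trans _ gt4).
have [b Tb nb] : exists2 b, b \in T & b \notin [set 1; a].
  apply/subsetPn/negP => /subset_leq_card; rewrite cards2 leqNgt (leq_trans _ gt4) //.
  by case: (_ != a).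
have [c Tc nc] : exists2 c, c \in T & c \notin [:: 1; a; b; a * b].
  by apply/subsetPn/negP => /subset_leq_card/leq_trans/(_ (card_size _));
    rewrite leqNgt gt4.
move: na nb nc; rewrite !inE !negb_or => a1 /andP[b1 ba] /and4P[c1 ca cb cab].
pose x (i : 'I_3) : gT := nth 1 [:: a; b; c] i.
have Tx i : x i \in T by case: i => [[|[|[|]]]].
have x1 i : x i != 1 by case: i => [[|[|[|]]]].
have xx i j : i <> j -> x i != x j.
  by case: i j => [[|[|[|i]]] // ?] [[|[|[|j]]] // ?] ne; rewrite /x /= 1?eq_sym //;
    case: ne; apply: val_inj.
(* Such a relation makes the product of all three trivial, in any order, hence [c = a * b]. *)
have xyz i j k : i <> j -> j <> k -> i <> k -> x i != x j * x k.
  have abc : a * b * c != 1.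
    by apply: contraNneq cab => e; rewrite -[X in X == _]mul1g -e -mulgA sq // mulg1.
  move=> nij njk nik; apply: contraNneq abc => e.
  have : x i * x j * x k = 1 by rewrite -mulgA -e sq.
  case: i j k nij njk nik {e} => [[|[|[|i]]] // ?] [[|[|[|j]]] // ?] [[|[|[|k]]] //
    ?] nij njk nik;
    try (by case: nij; apply: val_inj); try (by case: njk; apply: val_inj);
    try (by case: nik; apply: val_inj); rewrite /x /= => <-.
  - by [].
  - by rewrite -!mulgA (cT b c Tb Tc).
  - by rewrite (cT a b Ta Tb).
  - by rewrite (cT (b * c) a (groupM Tb Tc) Ta) mulgA.
  - by rewrite -[c * a * b]mulgA (cT c (a * b) Tc (groupM Ta Tb)).
  - by rewrite (cT c b Tc Tb) (cT (b * c) a (groupM Tb Tc) Ta) mulgA.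
have cyc u v : v \in T -> in_cyc (u : gG) v -> u = 1 \/ u = v.
  move=> Tv; rewrite /in_cyc !gpowE => -[|[|[|]]] ->;
    [by left | by right | left | right].
    exact: sq.
  by rewrite expgS expg2 sq // mulg1.
have pow15 u : u \in T -> gpow (u : gG) 15 = gone gG -> u = 1.
  move=> Tu; rewrite gpowE (expgS u 14) (expgM u 2 7) expg2 sq // expg1n mulg1 //.
have nxy i j : i <> j -> x i * x j <> 1.
  move=> /xx/negP nij e; apply: nij; apply/eqP.
  by rewrite -[x i]mulg1 -(sq (x j)) // mulgA e mul1g.
case: (d5 x) => [[[i [j [nij]]] | [[i [j [k [[nij njk nik]]]]] | [i [j [k [[nij njk
  nik]]]]]]] | ].
- by case/(cyc _ _ (Tx j)) => /eqP; rewrite ?(negPf (x1 i)) ?(negPf (xx i j nij)).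
- case/(cyc _ _ (groupM (Tx j) (Tx k))) => /eqP; first by rewrite (negPf (x1 i)).
  by rewrite (negPf (xyz i j k _ _ _)).
- case/(cyc _ _ (groupM (Tx j) (Tx k))) => [/(nxy _ _ nij) // | e].
  have : x j * x i = x j * x k by rewrite -(cT _ _ (Tx i) (Tx j)); exact: e.
  by move/mulgI/eqP; rewrite (negPf (xx i k nik)).
case=> [[i]|[[i [j [nij]]]|[[i [j [nij]]]|[i [j [nij]]]]]].
- by move/(pow15 _ (Tx i))/eqP; rewrite (negPf (x1 i)).
- by move/(pow15 _ (groupM (Tx i) (Tx j)))/nxy.
- have -> : gmul (x i : gG) (gpow (x j : gG) 2) = x i by rewrite gpowE /= expg2 sq //
  mulg1.
  by move/(pow15 _ (Tx i))/eqP; rewrite (negPf (x1 i)).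
have -> : gmul (x i : gG) (gpow (x j : gG) 3) = x i * x j.
  by rewrite gpowE /= expgS expg2 sq // mulg1.
by move/(pow15 _ (groupM (Tx i) (Tx j)))/nxy.
Qed.

(** In exponent 5 a trivial 12th power means a trivial element, as 25 = 1 + 24. So (7) puts any
    nontrivial [y] into the cycle of any nontrivial [x]. *)
Lemma did7_5group (d2 : did2 gG) (d7 : did7 gG) T : 5.-group T -> #|T| %| 5.
Proof.
move=> pT; have pow5 x : x \in T -> x ^+ 5 = 1.
  by move=> Tx; apply: (did2_pexp (p := 5) d2) (mem_p_elt pT Tx).
have pow12 z : z \in T -> gpow (z : gG) 12 = gone gG -> z = 1.
  move=> Tz; rewrite gpowE => e.
  have : z ^+ 25 = 1 by rewrite (expgM z 5 5) (pow5 z Tz) expg1n.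
  by rewrite (expgS z 24) (expgM z 12 2) e expg1n mulg1.
have [-> | ntT] := eqVneq T 1%G; first by rewrite cards1.
have [x Tx ntx] := trivgPn _ ntT.
suff -> : T :=: <[x]> by rewrite -orderE order_dvdn pow5.
apply/eqP; rewrite eqEsubset cycle_subG Tx andbT; apply/subsetP=> y Ty.
have [->|nty] := eqVneq y 1; first exact: group1.
case: (d7 y x) => [/(pow12 _ Ty)/eqP|[/(pow12 _ Tx)/eqP|[d [_]]]].
- by rewrite (negPf nty).
- by rewrite (negPf ntx).
rewrite [gpow (x : gG) d]gpowE => /(pow12 _ (groupM Ty (groupX d Tx))) e.
by rewrite -(groupMr _ (mem_cycle x d)) e group1.
Qed.

(** With [x ^ y = x ^+ 2] the three products in (6) are [x ^+ 3], [x ^+ 7] and [x ^+ 4], whose 12th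
    powers are nontrivial since 5 divides none of 36, 84, 48. *)
Lemma did6_frob20 (d6 : did6 gG) x y : #[x] = 5 -> #[y] = 4 -> x ^ y != x ^+ 2.
Proof.
move=> ox oy; apply/eqP => exy.
have pow n : gpow (x : gG) n = gone gG -> 5 %| n.
  by rewrite gpowE => e; rewrite -ox order_dvdn; apply/eqP.
case: (d6 x y) => [/pow // | [|]]; first by rewrite gpowE => /eqP;
  rewrite -order_dvdn oy.
have e1 : ginv (y : gG) = y^-1 by [].
have -> : gmul (ginv (y : gG)) (gmul (x : gG) (y : gG)) = x ^+ 2 :> gT by rewrite -exy.
have -> : gmul (ginv (y : gG)) (gmul (gpow (x : gG) 3) (y : gG)) = x ^+ 6 :> gT.
  by rewrite gpowE -[LHS]/((x ^+ 3) ^ y) conjXg exy -expgM.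
rewrite !gpowE => -[|[|]] /eqP; rewrite /= -?expgS -?expgD -expgM -order_dvdn ox //.
Qed.

End FromIdentities.

(** * From an abstract group to a section *)

Lemma a6_like_dids (gT : finGroupType) :
  all_dids (group_of_fin gT) -> a6_like [set: gT].
Proof.
case=> _ [d2 [d3 [d4 [d5 [d6 d7]]]]]; split.
- by move=> x _; apply: did2_order.
- by move=> T _; apply: did5_2abelem.
- by move=> T x y _; apply: did4_cycle4.
- by move=> T _; apply: did3_3group.
- by move=> T _; apply: did7_5group.
- by move=> x y _ _; apply: did6_frob20.
Qed.

(** By (1) there is a largest [k] admitting an injection of ['I_k] into [G]; such an injection is
    onto, as a missed element would extend it. *)
Lemma did1_finite (G : agroup) : did1 G ->
  exists (n : nat) (f : G -> 'I_n) (g : 'I_n -> G), cancel f g.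
Proof.
move=> d1; pose P k := exists x : 'I_k -> G, injective x.
have [k [[x injx] maxk]] : exists k, P k /\ ~ P k.+1.
  apply: NNPP => noP; have Pk k : P k.
    elim: k => [|k Pk]; first by exists (fun i : 'I_0 => gone G); case.
    by apply: NNPP => nPk; apply: noP; exists k.
  have [x injx] := Pk 361; have [i [j [lt /injx e]]] := d1 x.
  by rewrite e ltnn in lt.
have surj y : exists i, x i = y.
  apply: NNPP => ny; apply: maxk.
  exists (fun i => if unlift ord_max i is Some j then x j else y) => i j.
  case: unliftP => [i' ->|->]; case: unliftP => [j' ->|->] //.
  - by move/injx->.
  - by move=> e; case: ny; exists i'.
  - by move=> e; case: ny; exists j'.
exists k, (fun y => proj1_sig (constructive_indefinite_description _ (surj y))), x.
by move=> y; case: constructive_indefinite_description.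
Qed.

Section FinGroupOf.

Variables (G : agroup) (n : nat) (f : G -> 'I_n) (g : 'I_n -> G) (fK : cancel f g).

(* The carrier of [G] itself, so that the operations of [group_of_fin] are
   convertible to those of [G] and the identities need no transport. *)
Definition fin_carrier & cancel f g : Type := G.
Local Notation T := (fin_carrier fK).

HB.instance Definition _ := Finite.copy T (can_type fK).
HB.instance Definition _ := Finite_isGroup.Build T (@gmulA G) (@gmul1 G) (@gmulV G).

Lemma all_dids_fin : all_dids G -> all_dids (group_of_fin T).
Proof. by []. Qed.

End FinGroupOf.

(** The section is the isomorphic copy [K] divided by the trivial subgroup. *)
Lemma section_of_embeds (gT : finGroupType) : embeds_Alt6 [set: gT] ->
  exists (H N : {group {perm 'I_6}}), [/\ H \subset 'Alt_('I_6), N <| H &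
    exists f : gT -> coset_of N, [/\ forall x y, f (x * y) = f x * f y,
      injective f & forall c, c \in H / N <-> exists x, f x = c]].
Proof.
case=> K sKA /isogP[f injf fK]; exists K, 1%G; split; rewrite ?normal1 //.
have N1 (s : {perm 'I_6}) : s \in 'N(1%G) by rewrite /= norm1 inE.
have fT x : x \in [set: gT] by rewrite inE.
exists (fun x => coset 1 (f x)); split=> [x y | x y e | c].
- by rewrite morphM // morphM.
- exact: (injmP injf) (injmP (coset1_injm _) _ _ (N1 _) (N1 _) e).
rewrite -fK; split=> [/morphimP[_ _ /morphimP[x _ _ ->] ->] | [x <-]];
  first by exists x.
by apply: mem_morphim (N1 _) (mem_morphim _ _ _).
Qed.

Theorem theorem3 :
  all_dids A6 /\
  forall G : agroup, all_dids G -> is_section_of G ('Alt_('I_6))%G.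
Proof.
split; first exact: A6_all_dids.
move=> G dG; have [n [f [g fK]]] := did1_finite (proj1 dG).
have := section_of_embeds (a6_like_embeds (a6_like_dids (all_dids_fin fK dG))).
exact.
Qed.
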